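(* \textsc{Imbalance} parameterized by the size of a twin cover is in XP: there is an algorithm that, given a graph $G$ on $n$ vertices (given explicitly, e.g. by adjacency lists or matrix), a twin cover $S\subseteq V(G)$ of $G$ with $|S|=k$, and an integer $t$, decides whether $\mathcal{I}(G)\le t$ in time $f(k)\cdot n^{g(k)}$ for some computable functions $f,g$.
   Context: All graphs are finite, simple and undirected. A layout of $G=(V,E)$ is a linear ordering $\sigma$ of $V$; for $v\in V$, $N_L(v,\sigma)$ (resp. $N_R(v,\sigma)$) is the set of neighbours of $v$ preceding (resp. following) $v$ in $\sigma$. The imbalance of $v$ is $\mathcal{I}(v,\sigma)=\big||N_L(v,\sigma)|-|N_R(v,\sigma)|\big|$, $\mathcal{I}(\sigma)=\sum_{v}\mathcal{I}(v,\sigma)$, and $\mathcal{I}(G)=\min_\sigma\mathcal{I}(\sigma)$ over all layouts. A twin cover of $G$ is a set $S\subseteq V$ such that every connected component $X$ of $G-S$ is a set of true twins in $G$ ($N[u]=N[v]$ for all $u,v\in X$). *)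

(* Defs.v *)
From mathcomp Require Import all_boot all_order all_fingroup all_algebra.
Set Implicit Arguments. Unset Strict Implicit. Unset Printing Implicit Defensive.

(* Graphs: a finite simple graph on vertex set 'I_n is a symmetric,    *)
(* irreflexive relation e : rel 'I_n (checked by hypotheses).          *)

Section Graphs.
Variable n : nat.
Variable e : rel 'I_n.

(* A layout sigma is a bijection V -> positions {0..n-1}; u precedes v *)
(* iff sigma u < sigma v.                                                *)
Definition NL (s : {perm 'I_n}) (v : 'I_n) : {set 'I_n} :=
  [set u | e v u & (s u < s v)%N].
Definition NR (s : {perm 'I_n}) (v : 'I_n) : {set 'I_n} :=
  [set u | e v u & (s v < s u)%N].

Definition absdiff (a b : nat) : nat := ((a - b) + (b - a))%N.

Definition vertex_imbalance (s : {perm 'I_n}) (v : 'I_n) : nat :=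
  absdiff #|NL s v| #|NR s v|.

Definition layout_imbalance (s : {perm 'I_n}) : nat :=
  (\sum_(v : 'I_n) vertex_imbalance s v)%N.

Definition imbalance : nat :=
  layout_imbalance [arg min_(s < (1%g : {perm 'I_n})) layout_imbalance s].

Definition closed_nbhd (u : 'I_n) : {set 'I_n} := [set w | (w == u) || e u w].

Definition rel_minus (S : {set 'I_n}) : rel 'I_n :=
  fun a b => [&& e a b, a \notin S & b \notin S].

Definition twin_cover (S : {set 'I_n}) : Prop :=
  forall u v : 'I_n, u \notin S -> v \notin S ->
    connect (rel_minus S) u v -> closed_nbhd u = closed_nbhd v.

End Graphs.

(* Machine model: a unit-cost RAM with indirect addressing over nat    *)
(* registers (successor RAM).                                          *)

Inductive instr : Type :=
| INC   of nat
| DEC   of nat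
| JZ    of nat & nat
| CPY   of nat & nat
| LOAD  of nat & nat
| STORE of nat & nat.

Definition program := seq instr.
Definition memory := nat -> nat.

Definition upd (m : memory) (r v : nat) : memory :=
  fun x => if x == r then v else m x.

Definition step_instr (i : instr) (pc : nat) (m : memory) : nat * memory :=
  match i with
  | INC r => (pc.+1, upd m r (m r).+1)
  | DEC r => (pc.+1, upd m r (m r).-1)
  | JZ r l => (if m r == 0 then l else pc.+1, m)
  | CPY d s => (pc.+1, upd m d (m s))
  | LOAD d a => (pc.+1, upd m d (m (m a)))
  | STORE a s => (pc.+1, upd m (m a) (m s))
  end.

Fixpoint exec (P : program) (fuel : nat) (pc : nat) (m : memory)
  : option memory :=
  if (size P <= pc)%N then Some m else
  match fuel with
  | 0 => None
  | f.+1 => let pm := step_instr (nth (INC 0) P pc) pc m in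
            exec P f pm.1 pm.2
  end.

Definition computable (f : nat -> nat) : Prop :=
  exists P : program, forall x : nat, exists fuel m,
    exec P fuel 0 (fun r => if r == 0 then x else 0) = Some m /\ m 0 = f x.

(* Encoding of an instance (G, S, t) in the initial memory:            *)
(*   R[0] = n, R[1] = [t < 0], R[2] = |t|,                               *)
(*   R[3+i] = [i \in S]  (i < n),                                        *)
(*   R[3+n+i*n+j] = [ij is an edge]  (adjacency matrix), all else 0.     *)
Definition encode (n : nat) (e : rel 'I_n) (S : {set 'I_n}) (t : int)
  : memory :=
  fun x =>
    if x == 0 then n
    else if x == 1 then nat_of_bool (t < 0)%R
    else if x == 2 then `|t|%N
    else nat_of_bool
      ([exists i : 'I_n, (x == 3 + i)%N && (i \in S)]
       || [exists i : 'I_n, exists j : 'I_n,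
             (x == 3 + n + i * n + j)%N && e i j]).

(* Main.v *)
(* The vertices outside the twin cover S form cliques of true twins.  Seen from
   such a clique X, a layout only matters through the order of S and through the
   numbers theta_v of vertices of X placed before v, for v in S: the j-th vertex
   of X has on its left the j previous vertices of X and the neighbours v in S
   with theta_v <= j.  The imbalance of v in S is determined by the order of S
   and by the sum of theta_v over the cliques adjacent to v.  Conversely, every
   order of S and every family of theta's monotone along that order come from a
   layout.  A state consisting of the positions of S, the partial sums of
   theta_v and the cost of the cliques treated so far is a number with 2k + 2
   digits in base n + 1; the reachable states are tabulated clique by clique,
   trying the at most (n + 1)^k vectors theta for each clique.

   On the machine, every loop makes at most M = c (n + 1)^(4k + 8) turns, so the
   running time is polynomial in M with an exponent given by the nesting of the
   loops of one fixed program. *)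
Require Import Defs.
From mathcomp Require Import all_boot all_order all_fingroup all_algebra zify.
Set Implicit Arguments. Unset Strict Implicit. Unset Printing Implicit Defensive.

(** * Structured programs on the RAM *)


(** The input fills the registers from 0 on, but a fixed program needs fixed registers for its
    variables and temporaries. Only the cells below the constant [K] collide with them. Apart from n
    and |t| they hold bits, so they are packed into one number below 2^(K-2), and every later access
    to S or to an edge goes through [eCell]. The integer t is not bounded in terms of n and k, so
    |t| is truncated above every possible cost before it enters a computation.

    The machine counts by ones: sums, products and quotients are loops, so each value that drives a
    loop has to be at most M. A quotient of a by b forms the multiples of b up to a * b; the largest
    such product pairs a table index, below (n + 1)^(2k + 3), with the row length (n + 1)^(2k + 2),
    which the exponent 4k + 8 covers. Expressions have no conditional: all subterms are evaluated,
    even where their value is discarded, so the size bounds are proved for arbitrary choices and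
    states, not only for the meaningful ones. *)

Notation zr := 3.

Inductive cmd : Type :=
| Skip
| Basic of instr
| Seq of cmd & cmd
| Ifnz of nat & cmd
| While of nat & cmd.

Declare Scope cmd_scope.
Delimit Scope cmd_scope with cmd.
Notation "c1 ;; c2" := (Seq c1 c2)
  (at level 80, right associativity, format "c1 ;;  c2") : cmd_scope.
Bind Scope cmd_scope with cmd.

Definition is_basic (i : instr) : bool := if i is JZ _ _ then false else true.

(* [JZ zr pc] is used as an unconditional jump: register [zr] is kept at 0. *)
Fixpoint code (c : cmd) (pc : nat) : program :=
  match c with
  | Skip => [::]
  | Basic i => [:: i]
  | Seq a b => let p := code a pc in p ++ code b (pc + size p)
  | Ifnz r a => let p := code a pc.+1 in JZ r (pc + (size p).+1) :: p
  | While r a =>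
      let p := code a pc.+1 in JZ r (pc + (size p).+2) :: p ++ [:: JZ zr pc]
  end.

(** The last argument counts machine steps; a turn of a loop costs its body and two jumps. The
    premise [m1 zr = 0] makes the closing [JZ zr] jump back. *)
Inductive bigstep : cmd -> memory -> memory -> nat -> Prop :=
| bs_skip m : bigstep Skip m m 0
| bs_basic i m : is_basic i -> bigstep (Basic i) m (step_instr i 0 m).2 1
| bs_seq a b m m1 m2 t1 t2 : bigstep a m m1 t1 -> bigstep b m1 m2 t2 ->
    bigstep (Seq a b) m m2 (t1 + t2)
| bs_ifz r a m : m r = 0 -> bigstep (Ifnz r a) m m 1
| bs_ifnz r a m m1 t : m r <> 0 -> bigstep a m m1 t ->
    bigstep (Ifnz r a) m m1 t.+1
| bs_while0 r a m : m r = 0 -> bigstep (While r a) m m 1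
| bs_whileS r a m m1 m2 t1 t2 : m r <> 0 -> bigstep a m m1 t1 -> m1 zr = 0 ->
    bigstep (While r a) m1 m2 t2 -> bigstep (While r a) m m2 (t1 + t2).+2.

Lemma exec_step P f pc m : pc < size P ->
  exec P f.+1 pc m =
  exec P f (step_instr (nth (INC 0) P pc) pc m).1
           (step_instr (nth (INC 0) P pc) pc m).2.
Proof. by rewrite ltnNge => /negbTE /= ->. Qed.

Lemma step_basic i pc m : is_basic i ->
  step_instr i pc m = (pc.+1, (step_instr i 0 m).2).
Proof. by case: i. Qed.

(** Jump targets are absolute, so the code has to be placed in an arbitrary context [pre], [post]
    for the induction; the spare fuel [f] lets consecutive pieces compose. *)
Lemma exec_code c m m' t : bigstep c m m' t ->
  forall P pre post f, P = pre ++ code c (size pre) ++ post ->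
  exec P (t + f) (size pre) m = exec P f (size pre + size (code c (size pre))) m'.
Proof.
elim=> {c m m' t}.
- by move=> m P pre post f _; rewrite addn0.
- move=> i m bi P pre post f ->.
  rewrite add1n exec_step; last by rewrite size_cat /=; lia.
  by rewrite nth_cat ltnn subnn /= step_basic // addn1.
- move=> a b m m1 m2 t1 t2 _ IH1 _ IH2 P pre post f /=.
  set p := code a (size pre) => defP.
  rewrite -addnA (IH1 P pre (code b (size pre + size p) ++ post)); last first.
    by rewrite defP -!catA.
  rewrite -/p -size_cat (IH2 P (pre ++ p) post).
    by rewrite !size_cat addnA.
  by rewrite defP size_cat -!catA.
- move=> r a m mr P pre post f ->.
  rewrite add1n exec_step; last by rewrite size_cat /=; lia.
  by rewrite nth_cat ltnn subnn /= mr.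
- move=> r a m m1 t mr _ IH P pre post f.
  set p := code a (size pre).+1 => defP.
  pose pre1 := rcons pre (JZ r (size pre + (size p).+1)).
  have sz : size pre1 = (size pre).+1 by rewrite size_rcons.
  have pcP : size pre < size P by rewrite defP size_cat /=; lia.
  have nthP : nth (INC 0) P (size pre) = JZ r (size pre + (size p).+1).
    by rewrite defP nth_cat ltnn subnn.
  have defP1 : P = pre1 ++ code a (size pre1) ++ post.
    by rewrite sz defP /pre1 -cats1 -catA.
  rewrite addSn exec_step // nthP [step_instr _ _ _]/= (introF eqP mr).
  by rewrite -{1}sz (IH P pre1 post) // sz /= addnS addSn.
- move=> r a m mr P pre post f ->.
  rewrite add1n exec_step; last by rewrite size_cat /=; lia.
  by rewrite nth_cat ltnn subnn /= mr /= size_cat addn1.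
- move=> r a m m1 m2 t1 t2 mr _ IH1 m1z _ IH2 P pre post f defP.
  have IH2' := IH2 P pre post f defP; move: defP IH2'; set p := code a (size pre).+1.
  pose pre1 := rcons pre (JZ r (size pre + (size p).+2)).
  have sz : size pre1 = (size pre).+1 by rewrite size_rcons.
  rewrite [code (While r a) _]/= -/p => defP IH2'.
  have szP : (size pre).+1 + size p < size P.
    by rewrite defP size_cat /= !size_cat /=; lia.
  have nthP : nth (INC 0) P (size pre) = JZ r (size pre + (size p).+2).
    by rewrite defP nth_cat ltnn subnn.
  have nthP' : nth (INC 0) P ((size pre).+1 + size p) = JZ zr (size pre).
    rewrite defP nth_cat ifN; last by rewrite -leqNgt; lia.
    rewrite (_ : _ - _ = (size p).+1); last by lia.
    by rewrite /= -catA nth_cat ltnn subnn.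
  have defP1 : P = pre1 ++ code a (size pre1) ++ (JZ zr (size pre) :: post).
    by rewrite sz defP /pre1 -cats1 -!catA /= -catA.
  rewrite !addSn exec_step; last by lia.
  rewrite nthP [step_instr _ _ _]/= (introF eqP mr) -addSn -addnS -addnA.
  rewrite -{1}sz (IH1 P pre1 _ _ defP1) sz -/p addSn addnS -addSn.
  rewrite [_ + _]addSn exec_step // nthP' [step_instr _ _ _]/= m1z eqxx.
  exact: IH2'.
Qed.

Lemma exec_program c m m' t fuel : bigstep c m m' t -> t <= fuel ->
  exec (code c 0) fuel 0 m = Some m'.
Proof.
move=> bs le_t; rewrite -(subnKC le_t).
rewrite (exec_code bs (P := code c 0) (pre := [::]) (post := [::])) ?cats0 //=.
by rewrite add0n; case: (fuel - t) => [|f] /=; rewrite leqnn.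
Qed.

(* An upper bound on the running time when every loop makes at most [M] turns. *)
Fixpoint ccost (M : nat) (c : cmd) : nat :=
  match c with
  | Skip => 0
  | Basic _ => 1
  | Seq a b => ccost M a + ccost M b
  | Ifnz _ a => (ccost M a).+1
  | While _ a => M * (ccost M a).+2 + 1
  end.

(** A loop multiplies the cost by [M] and so raises the degree by one. The constants depend on the
    command alone, so for a fixed program this is a polynomial in [M]. *)
Lemma ccost_poly c : exists C D, forall M, ccost M c <= C * M.+1 ^ D.
Proof.
have mono M D D' : D <= D' -> M.+1 ^ D <= M.+1 ^ D' by move=> ?; exact: leq_pexp2l.
have pos M D : 0 < M.+1 ^ D by rewrite expn_gt0.
elim: c => [|i|a [C1 [D1 H1]] b [C2 [D2 H2]]|r a [C [D H]]|r a [C [D H]]].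
- by exists 0, 0.
- by exists 1, 0 => M; rewrite /= expn0.
- exists (C1 + C2), (D1 + D2) => M /=; rewrite mulnDl leq_add //.
    by apply: leq_trans (H1 M) _; rewrite leq_mul2l mono ?orbT // leq_addr.
  by apply: leq_trans (H2 M) _; rewrite leq_mul2l mono ?orbT // leq_addl.
- by exists C.+1, D => M /=; rewrite mulSn -add1n leq_add.
- exists C.+3, D.+1 => M /=.
  have := H M; have := pos M D; rewrite expnS; set X := M.+1 ^ D => X0 HX.
  nia.
Qed.

(** * Total correctness with a syntactic time bound *)

Definition runs (M : nat) (c : cmd) (m : memory) (Q : memory -> Prop) : Prop :=
  exists m' t, [/\ bigstep c m m' t, t <= ccost M c & Q m'].

Section Runs.
Variable M : nat.
Implicit Types (c : cmd) (m : memory) (Q : memory -> Prop).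

Lemma runs_skip m Q : Q m -> runs M Skip m Q.
Proof. by exists m, 0; split => //; constructor. Qed.

Lemma runs_basic i m Q :
  is_basic i -> Q (step_instr i 0 m).2 -> runs M (Basic i) m Q.
Proof. by move=> bi Qm; exists (step_instr i 0 m).2, 1; split => //; constructor. Qed.

Lemma runs_seq a b m Q :
  runs M a m (fun m1 => runs M b m1 Q) -> runs M (Seq a b) m Q.
Proof.
move=> [m1 [t1 [bs1 le1 [m2 [t2 [bs2 le2 Q2]]]]]].
by exists m2, (t1 + t2); split; [apply: bs_seq bs1 bs2|exact: leq_add|].
Qed.

Lemma runs_ifnz r a m Q :
  (m r = 0 -> Q m) -> (m r <> 0 -> runs M a m Q) -> runs M (Ifnz r a) m Q.
Proof.
move=> Q0 QS; case: (eqVneq (m r) 0) => [m0|/eqP m0].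
  by exists m, 1; split; [exact: bs_ifz| |exact: Q0].
have [m1 [t [bs le_t Q1]]] := QS m0.
by exists m1, t.+1; split => //; exact: bs_ifnz.
Qed.

(* [I j] is the invariant with [j] turns left. *)
Lemma runs_while (I : nat -> memory -> Prop) r a N m :
  (forall m, I 0 m -> m r = 0) ->
  (forall j m, j < N -> I j.+1 m ->
     m r <> 0 /\ runs M a m (fun m' => m' zr = 0 /\ I j m')) ->
  N <= M -> I N m -> runs M (While r a) m (I 0).
Proof.
move=> I0 IS leNM.
suff H j m0 : j <= N -> I j m0 -> exists m' t,
    [/\ bigstep (While r a) m0 m' t, t <= j * (ccost M a).+2 + 1 & I 0 m'].
  move=> /(H N m (leqnn N)) [m' [t [bs le_t Im]]]; exists m', t; split => //=.
  by apply: leq_trans le_t _; rewrite leq_add2r leq_mul2r leNM orbT.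
elim: j m0 => [|j IH] m0 le_j Ij.
  by exists m0, 1; split => //; apply: bs_while0; exact: I0.
have [mr [m1 [t1 [bs1 le1 [z1 I1]]]]] := IS _ _ le_j Ij.
have [m2 [t2 [bs2 le2 I2]]] := IH m1 (ltnW le_j) I1.
exists m2, (t1 + t2).+2; split => //; first exact: bs_whileS bs1 z1 bs2.
by rewrite mulSn; lia.
Qed.

Lemma runs_mono c m Q Q' : (forall m', Q m' -> Q' m') -> runs M c m Q -> runs M c m Q'.
Proof. by move=> QQ [m' [t [? ? /QQ]]]; exists m', t. Qed.

End Runs.

Fixpoint repeat_cmd (j : nat) (c : cmd) : cmd :=
  if j is j'.+1 then Seq c (repeat_cmd j' c) else Skip.

Lemma runs_incs M r j m : runs M (repeat_cmd j (Basic (INC r))) m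
  (fun m' => m' r = m r + j /\ forall x, x != r -> m' x = m x).
Proof.
elim: j m => [|j IH] m /=; first by apply: runs_skip; rewrite addn0.
apply: runs_seq; apply: runs_basic => //=.
apply: runs_mono (IH _) => m' [-> Hx]; split; first by rewrite /upd eqxx addSnnS.
by move=> x xr; rewrite Hx // /upd (negbTE xr).
Qed.

(** * Arithmetic expressions *)

(* Variables are the registers below [nv]; the registers from [nv] to [K] hold
   temporaries, and [Rd] reads the cells from [K] on. *)
Notation nv := 32.

Inductive exp : Type :=
| Cst of nat
| Var of nat
| Succ of exp
| Pred of exp
| Rd of exp
| Fold (x y : nat) (en e0 b : exp)
| Let2 (x : nat) (a : exp) (y : nat) (b e : exp).

(* [Fold x y en e0 b] iterates [y := b] from [y = e0] for [x = 0, ..., en - 1];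
   [Let2] binds [x] and [y] simultaneously. *)
Inductive den (K M : nat) : memory -> exp -> nat -> Prop :=
| den_cst m c : den K M m (Cst c) c
| den_var m x : den K M m (Var x) (m x)
| den_succ m e v : den K M m e v -> den K M m (Succ e) v.+1
| den_pred m e v : den K M m e v -> den K M m (Pred e) v.-1
| den_rd m e v : den K M m e v -> K <= v -> den K M m (Rd e) (m v)
| den_fold m x y en e0 b n (F : nat -> nat) :
    den K M m en n -> n <= M -> den K M m e0 (F 0) ->
    (forall i, i < n -> den K M (upd (upd m x i) y (F i)) b (F i.+1)) ->
    den K M m (Fold x y en e0 b) (F n)
| den_let2 m x a y b e va vb v :
    den K M m a va -> den K M m b vb -> den K M (upd (upd m x va) y vb) e v ->
    den K M m (Let2 x a y b e) v.

Definition isname (x : nat) : bool := (x < nv) && (x != zr).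

Fixpoint wf (e : exp) : bool :=
  match e with
  | Cst _ => true
  | Var x => isname x
  | Succ e | Pred e | Rd e => wf e
  | Fold x y en e0 b =>
      [&& isname x, isname y, x != y, wf en, wf e0 & wf b]
  | Let2 x a y b e => [&& isname x, isname y, x != y, wf a, wf b & wf e]
  end.

Fixpoint regs (e : exp) : nat :=
  match e with
  | Cst _ | Var _ => 1
  | Succ e | Pred e | Rd e => regs e
  | Fold _ _ a b e | Let2 _ a _ b e =>
      maxn (regs a) (maxn (regs b).+1 (regs e + 4))
  end.

Local Open Scope cmd_scope.

(** The value is left in register [d]. Binders park the old values of their names in [d.+2] and
    [d.+3] and restore them afterwards, so nested expressions may reuse names freely. *)
Fixpoint compile (d : nat) (e : exp) : cmd :=
  match e with
  | Cst c => Basic (CPY d zr) ;; repeat_cmd c (Basic (INC d))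
  | Var x => Basic (CPY d x)
  | Succ e => compile d e ;; Basic (INC d)
  | Pred e => compile d e ;; Basic (DEC d)
  | Rd e => compile d e ;; Basic (LOAD d d)
  | Fold x y en e0 b =>
      compile d en ;; compile d.+1 e0 ;;
      Basic (CPY d.+2 x) ;; Basic (CPY d.+3 y) ;;
      Basic (CPY x zr) ;; Basic (CPY y d.+1) ;;
      While d (compile d.+4 b ;; Basic (CPY y d.+4) ;; Basic (INC x) ;;
               Basic (DEC d)) ;;
      Basic (CPY d y) ;; Basic (CPY x d.+2) ;; Basic (CPY y d.+3)
  | Let2 x a y b e =>
      compile d a ;; compile d.+1 b ;;
      Basic (CPY d.+2 x) ;; Basic (CPY d.+3 y) ;;
      Basic (CPY x d) ;; Basic (CPY y d.+1) ;; compile d.+4 e ;;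
      Basic (CPY d d.+4) ;; Basic (CPY x d.+2) ;; Basic (CPY y d.+3)
  end.

Local Close Scope cmd_scope.

(** These are the registers an expression can read. The memory in [den] does not track temporaries,
    so the machine need not match it there. *)
Definition agree (K : nat) (m1 m2 : memory) : Prop :=
  forall r, r != zr -> (r < nv) || (K <= r) -> m1 r = m2 r.

Lemma regs_gt0 e : 0 < regs e.
Proof. by elim: e => //= *; lia. Qed.

Ltac upd_simpl :=
  rewrite /upd; repeat (case: eqP => [?|?]); try congruence; subst; try done; try lia.

Lemma runs_compile K M m e v : den K M m e v -> forall d m1,
  wf e -> nv <= d -> d + regs e <= K -> agree K m1 m -> m1 zr = 0 ->
  runs M (compile d e) m1
    (fun m2 => m2 d = v /\ forall r, (r < d) || (K <= r) -> m2 r = m1 r).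
Proof.
elim=> {m e v}.
- move=> m c d m1 _ nvd dK ag z0; apply: runs_seq; apply: runs_basic => //.
  apply: runs_mono (runs_incs _ _ _ _) => m2 /= [-> Hx].
  split; first by rewrite /upd eqxx z0.
  by move=> r Hr; rewrite Hx; upd_simpl; move: dK => /=; lia.
- move=> m x d m1 /= /andP[xnv xz] nvd dK ag z0; apply: runs_basic => //=.
  split; first by rewrite /upd eqxx ag // xnv.
  by move=> r Hr; upd_simpl.
- move=> m e v _ IH d m1 /= we nvd dK ag z0; apply: runs_seq.
  apply: runs_mono (IH _ _ we nvd dK ag z0) => m2 [v2 Hr].
  apply: runs_basic => //=; split; first by rewrite /upd eqxx v2.
  by move=> r lr; rewrite -Hr //; have := regs_gt0 e; upd_simpl.
- move=> m e v _ IH d m1 /= we nvd dK ag z0; apply: runs_seq.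
  apply: runs_mono (IH _ _ we nvd dK ag z0) => m2 [v2 Hr].
  apply: runs_basic => //=; split; first by rewrite /upd eqxx v2.
  by move=> r lr; rewrite -Hr //; have := regs_gt0 e; upd_simpl.
- move=> m e v _ IH leKv d m1 /= we nvd dK ag z0; apply: runs_seq.
  apply: runs_mono (IH _ _ we nvd dK ag z0) => m2 [v2 Hr].
  apply: runs_basic => //=; split.
    by rewrite /upd eqxx v2 Hr ?leKv ?orbT // ag ?leKv ?orbT //; lia.
  by move=> r lr; rewrite -Hr //; have := regs_gt0 e; upd_simpl.
- move=> m x y en e0 b n F _ IHn leM _ IH0 _ IHb d m1 /=.
  move=> /and5P[/andP[xv xz] /andP[yv yz] xy wn /andP[w0 wb]] nvd dK ag z0.
  apply: runs_seq; apply: runs_mono (IHn d m1 wn nvd _ ag z0) => [m2 [v2 H2]|]; last by lia.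
  have ag2 : agree K m2 m by move=> r rz lr; rewrite H2 ?ag //; lia.
  apply: runs_seq; apply: runs_mono (IH0 d.+1 m2 w0 _ _ ag2 _) => [m3 [v3 H3]|||];
    [|by lia|by lia|by rewrite H2; lia].
  have [x0 y0 xny] : [/\ x != d, y != d & y != x] by split; lia.
  apply: runs_seq; apply: runs_basic => //=.
  apply: runs_seq; apply: runs_basic => //=.
  apply: runs_seq; apply: runs_basic => //=.
  apply: runs_seq; apply: runs_basic => //=.
  set m4 := upd _ y _.
  have h4 r : r != x -> r != y -> (r < d) || (K <= r) -> m4 r = m1 r.
    by move=> rx ry lr; rewrite -H2 // -H3; rewrite /m4; upd_simpl.
  have m3z : m3 zr = 0 by rewrite H3 ?H2; lia.
  have m3d : m3 d = n by rewrite H3; lia.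
  have m3x : m3 x = m1 x by rewrite H3 ?H2; lia.
  have m3y : m3 y = m1 y by rewrite H3 ?H2; lia.
  pose I j (mu : memory) := [/\ mu d = j, mu x = n - j, mu y = F (n - j) &
    [/\ mu d.+2 = m1 x, mu d.+3 = m1 y, mu zr = 0 &
      forall r, r != x -> r != y -> (r < d) || (K <= r) -> mu r = m1 r]].
  have I4 : I n m4.
    by rewrite /I subnn; split; last split => //; rewrite /m4; upd_simpl.
  apply: runs_seq; apply: runs_mono (runs_while (I := I) (N := n) _ _ leM I4); last first.
  + move=> j mu jn [Id Ix Iy [I2 I3 Iz Ir]]; split; first by rewrite Id.
    apply: runs_seq; apply: runs_mono (IHb (n - j.+1) _ d.+4 mu wb _ _ _ Iz) => [||||].
    * move=> m5 [v5 H5].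
      do 2![apply: runs_seq; apply: runs_basic => //=]; apply: runs_basic => //=.
      have h5 r : r != x -> r != y -> r < d.+4 -> r != d -> upd (upd (upd m5 y (m5 d.+4)) x ((upd m5 y (m5 d.+4)) x).+1) d (upd (upd m5 y (m5 d.+4)) x ((upd m5 y (m5 d.+4)) x).+1 d).-1 r = mu r.
        by move=> ? ? ? ?; rewrite -H5; upd_simpl.
      split; first by rewrite h5 //; lia.
      split; [| | |split].
      -- by rewrite {1}/upd eqxx -[RHS]/(j.+1.-1) -Id -H5; upd_simpl.
      -- have -> : n - j = (mu x).+1 by lia.
         by rewrite -H5; upd_simpl.
      -- have -> : n - j = (n - j.+1).+1 by lia.
         by rewrite -v5; upd_simpl.
      -- by rewrite h5; lia.
      -- by rewrite h5; lia.
      -- by rewrite h5; lia.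
      -- move=> r rx ry lr; have [rd|] := ltnP r d; first by rewrite h5 ?Ir; lia.
         by move=> ?; rewrite -Ir // -H5; upd_simpl.
    * by lia.
    * by lia.
    * by lia.
    * move=> r rz lr; rewrite /upd; case: eqP => [->|ry]; first by rewrite Iy.
      case: eqP => [->|rx]; first by rewrite Ix.
      by rewrite Ir ?ag //; lia.
  + by move=> mu [].
  + move=> m5 [Id Ix Iy [I2 I3 Iz Ir]].
    do 2![apply: runs_seq; apply: runs_basic => //=]; apply: runs_basic => //=.
    split; first by move: Iy; rewrite subn0; upd_simpl.
    move=> r lr; case: (eqVneq r x) => [->|rx]; first by move: I2; upd_simpl.
    case: (eqVneq r y) => [->|ry]; first by move: I3; upd_simpl.
    by rewrite -Ir //; have := regs_gt0 b; upd_simpl.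
- move=> m x a y b e va vb v _ IHa _ IHb _ IHe d m1 /=.
  move=> /and5P[/andP[xv xz] /andP[yv yz] xy wa /andP[wb we]] nvd dK ag z0.
  apply: runs_seq; apply: runs_mono (IHa d m1 wa nvd _ ag z0) => [m2 [v2 H2]|]; last by lia.
  have ag2 : agree K m2 m by move=> r rz lr; rewrite H2 ?ag //; lia.
  apply: runs_seq; apply: runs_mono (IHb d.+1 m2 wb _ _ ag2 _) => [m3 [v3 H3]|||];
    [|by lia|by lia|by rewrite H2; lia].
  do 4![apply: runs_seq; apply: runs_basic => //=].
  set m4 := upd _ y _.
  have m3d : m3 d = va by rewrite H3; lia.
  have h4 r : r != x -> r != y -> (r < d) || (K <= r) -> m4 r = m1 r.
    by move=> rx ry lr; rewrite -H2 // -H3; rewrite /m4; upd_simpl.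
  have m3x : m3 x = m1 x by rewrite H3 ?H2; lia.
  have m3y : m3 y = m1 y by rewrite H3 ?H2; lia.
  have m4x : m4 x = va by rewrite -m3d /m4; upd_simpl.
  have m4y : m4 y = vb by rewrite -v3 /m4; upd_simpl.
  have m42 : m4 d.+2 = m1 x by rewrite -m3x /m4; upd_simpl.
  have m43 : m4 d.+3 = m1 y by rewrite -m3y /m4; upd_simpl.
  apply: runs_seq; apply: runs_mono (IHe d.+4 m4 we _ _ _ _) => [m5 [v5 H5]||||].
  + do 2![apply: runs_seq; apply: runs_basic => //=]; apply: runs_basic => //=.
    split; first by move: v5; upd_simpl.
    move=> r lr; case: (eqVneq r x) => [->|rx].
      by rewrite -m42 -H5; upd_simpl.
    case: (eqVneq r y) => [->|ry]; first by rewrite -m43 -H5; upd_simpl.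
    by rewrite -h4 // -H5; have := regs_gt0 e; upd_simpl.
  + by lia.
  + by lia.
  + move=> r rz lr; rewrite /upd; case: eqP => [->|/eqP ry]; first by rewrite m4y.
    case: eqP => [->|/eqP rx]; first by rewrite m4x.
    by rewrite h4 ?ag //; lia.
  + by rewrite h4 //; lia.
Qed.

(* Name 8 is reserved for the accumulator of [eSum]; the library functions bind
   their arguments to 4 and 5 and loop over 6 with accumulator 7. *)
Definition eAdd a b := Let2 4 a 5 b (Fold 6 7 (Var 5) (Var 4) (Succ (Var 7))).
Definition eSub a b := Let2 4 a 5 b (Fold 6 7 (Var 5) (Var 4) (Pred (Var 7))).
Definition eMul a b :=
  Let2 4 a 5 b (Fold 6 7 (Var 4) (Cst 0) (eAdd (Var 7) (Var 5))).
Definition ePow a b :=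
  Let2 4 a 5 b (Fold 6 7 (Var 5) (Cst 1) (eMul (Var 7) (Var 4))).
Definition eSum x en b := Fold x 8 en (Cst 0) (eAdd (Var 8) b).
Definition eNot a := eSub (Cst 1) a.
Definition eLe a b := eNot (eSub a b).
Definition eLt a b := eNot (eLe b a).
Definition eOr a b := eNot (eMul (eNot a) (eNot b)).
Definition eImp a b := eNot (eMul a (eNot b)).
Definition eEq a b :=
  Let2 4 a 5 b (eMul (eLe (Var 4) (Var 5)) (eLe (Var 5) (Var 4))).
Definition eEx x en b := eNot (eNot (eSum x en b)).
Definition eAll x en b := eNot (eEx x en (eNot b)).
Definition eDiv a b :=
  Let2 4 a 5 b
    (eSum 6 (Var 4) (eLe (eMul (Succ (Var 6)) (Var 5)) (Var 4))).
Definition eMod a b :=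
  Let2 4 a 5 b (eSub (Var 4) (eMul (eDiv (Var 4) (Var 5)) (Var 5))).
Definition eAbsdiff a b :=
  Let2 4 a 5 b (eAdd (eSub (Var 4) (Var 5)) (eSub (Var 5) (Var 4))).

Lemma sum_ltn_const p q : \sum_(i < p) (i < q) = minn p q.
Proof.
elim: p => [|p IH]; first by rewrite big_ord0 min0n.
by rewrite big_ord_recr /= IH; lia.
Qed.

(** * Values of the arithmetic and logical operations *)

Section Library.
Variables K M : nat.
Hypothesis M_gt0 : 0 < M.
Local Notation D := (den K M).
Implicit Types (m : memory) (a b e : exp).

Lemma den_name m x v : m x = v -> D m (Var x) v.
Proof. by move=> <-; exact: den_var. Qed.

Lemma den_add m a b va vb :
  D m a va -> D m b vb -> vb <= M -> D m (eAdd a b) (va + vb).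
Proof.
move=> Da Db leM; apply: (den_let2 Da Db).
apply: (den_fold (F := fun i => va + i)) => //; try exact: den_name.
  by apply: den_name; rewrite addn0.
by move=> i _; rewrite addnS; apply: den_succ; exact: den_name.
Qed.

Lemma den_sub m a b va vb :
  D m a va -> D m b vb -> vb <= M -> D m (eSub a b) (va - vb).
Proof.
move=> Da Db leM; apply: (den_let2 Da Db).
apply: (den_fold (F := fun i => va - i)) => //; try exact: den_name.
  by apply: den_name; rewrite subn0.
by move=> i _; rewrite subnS; apply: den_pred; exact: den_name.
Qed.

Lemma den_mul m a b va vb : D m a va -> D m b vb ->
  va <= M -> vb <= M -> D m (eMul a b) (va * vb).
Proof.
move=> Da Db aM bM; apply: (den_let2 Da Db).
apply: (den_fold (F := fun i => i * vb)) => //; try exact: den_name.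
  exact: den_cst.
by move=> i _; rewrite mulSnr; apply: den_add => //; exact: den_name.
Qed.

Lemma den_pow m a b va vb : D m a va -> D m b vb -> 0 < va ->
  vb <= M -> va ^ vb <= M -> D m (ePow a b) (va ^ vb).
Proof.
move=> Da Db a0 bM abM; apply: (den_let2 Da Db).
apply: (den_fold (F := fun i => va ^ i)) => //; try exact: den_name.
  exact: den_cst.
move=> i ib; rewrite expnSr; apply: den_mul; try exact: den_name.
  by apply: leq_trans abM; exact/leq_pexp2l/ltnW.
by apply: leq_trans abM; rewrite -{1}[va]expn1; apply: leq_pexp2l; lia.
Qed.

(** The body is evaluated while name 8 holds some partial sum, hence the arbitrary [acc]. Nested
    sums share name 8 safely because [Fold] restores it. *)
Lemma den_sum m x en b n (f : nat -> nat) :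
  x != 8 -> D m en n -> n <= M ->
  (forall i acc, i < n -> D (upd (upd m x i) 8 acc) b (f i)) ->
  (forall i, i < n -> f i <= M) ->
  D m (eSum x en b) (\sum_(i < n) f i).
Proof.
move=> x8 Dn nM Db fM.
apply: (den_fold (F := fun j => \sum_(i < j) f i)) => //.
  by rewrite big_ord0; exact: den_cst.
move=> i lin; rewrite big_ord_recr /=.
by apply: den_add; [exact: den_name|exact: Db|exact: fM].
Qed.

Lemma den_not m a (P : bool) : D m a P -> D m (eNot a) (~~ P).
Proof.
move=> Da; have -> : ~~ P = 1 - P :> nat by case: P {Da}.
by apply: den_sub => //; [exact: den_cst|case: P {Da}].
Qed.

Lemma den_is0 m a v : D m a v -> v <= M -> D m (eNot a) (v == 0).
Proof.
move=> Da vM; have -> : (v == 0) = 1 - v :> nat by case: v {Da vM}.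
by apply: den_sub => //; exact: den_cst.
Qed.

Lemma den_le m a b va vb : D m a va -> D m b vb ->
  va <= M -> vb <= M -> D m (eLe a b) (va <= vb).
Proof.
move=> Da Db aM bM; rewrite -subn_eq0.
by apply: den_is0; [exact: den_sub|lia].
Qed.

Lemma den_lt m a b va vb : D m a va -> D m b vb ->
  va <= M -> vb <= M -> D m (eLt a b) (va < vb).
Proof. by move=> Da Db aM bM; rewrite ltnNge; apply: den_not; exact: den_le. Qed.

Lemma den_and m a b (P Q : bool) : D m a P -> D m b Q -> D m (eMul a b) (P && Q).
Proof. by move=> Da Db; rewrite -mulnb; apply: den_mul; rewrite // (leq_trans (leq_b1 _)). Qed.

Lemma den_or m a b (P Q : bool) : D m a P -> D m b Q -> D m (eOr a b) (P || Q).
Proof.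
move=> Da Db; rewrite -[P || Q]negbK negb_or.
by apply/den_not/den_and; apply: den_not.
Qed.

Lemma den_imp m a b (P Q : bool) : D m a P -> D m b Q -> D m (eImp a b) (P ==> Q).
Proof.
move=> Da Db; rewrite implybE -[_ || Q]negbK negb_or negbK.
by apply/den_not/den_and => //; apply: den_not.
Qed.

Lemma den_eqn m a b va vb : D m a va -> D m b vb ->
  va <= M -> vb <= M -> D m (eEq a b) (va == vb).
Proof.
move=> Da Db aM bM; apply: (den_let2 Da Db); rewrite eqn_leq.
by apply: den_and; apply: den_le; rewrite //; apply: den_name.
Qed.

Lemma den_ex m x en b n (P : nat -> bool) :
  x != 8 -> D m en n -> n <= M ->
  (forall i acc, i < n -> D (upd (upd m x i) 8 acc) b (P i)) ->
  D m (eEx x en b) [exists i : 'I_n, P i].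
Proof.
move=> x8 Dn nM Db.
have -> : [exists i : 'I_n, P i] = (\sum_(i < n) P i != 0).
  rewrite sum_nat_eq0 negb_forall; apply: eq_existsb => i.
  by rewrite eqb0 negbK.
apply/den_not/den_is0.
  by apply: (den_sum (f := fun i => P i)) => // i _; exact: leq_trans (leq_b1 _) _.
apply: leq_trans nM; rewrite -[leqRHS]card_ord -sum1_card.
by apply: leq_sum => i _; exact: leq_b1.
Qed.

Lemma den_all m x en b n (P : nat -> bool) :
  x != 8 -> D m en n -> n <= M ->
  (forall i acc, i < n -> D (upd (upd m x i) 8 acc) b (P i)) ->
  D m (eAll x en b) [forall i : 'I_n, P i].
Proof.
move=> x8 Dn nM Db; rewrite -[[forall i, _]]negbK negb_forall.
by apply/den_not/(den_ex (P := fun i => ~~ P i)) => // i acc lin; exact/den_not/Db.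
Qed.

(** The quotient is the number of positive multiples of [vb] that are at most [va]. The loop tries
    [va] multiples without stopping early, so the products reach [va * vb]. *)
Lemma den_div m a b va vb : D m a va -> D m b vb -> 0 < vb ->
  va * vb <= M -> D m (eDiv a b) (va %/ vb).
Proof.
move=> Da Db b0 abM; apply: (den_let2 Da Db).
have aM : va <= M by apply: leq_trans abM; rewrite leq_pmulr.
have -> : va %/ vb = \sum_(i < va) (i.+1 * vb <= va).
  under eq_bigr => i _ do rewrite -leq_divRL //.
  by rewrite sum_ltn_const; apply/esym/minn_idPr; exact: leq_div.
apply: (den_sum (f := fun i => i.+1 * vb <= va)) => //.
- exact: den_name.
- move=> i acc lia_; have iM : i.+1 * vb <= M by apply: leq_trans abM; rewrite leq_mul2r lia_ orbT.
  apply: den_le => //; last exact: den_name.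
  apply: den_mul; [by apply: den_succ; exact: den_name|exact: den_name|by lia|].
  by apply: leq_trans iM; rewrite leq_pmull.
- by move=> i _; exact: leq_trans (leq_b1 _) _.
Qed.

Lemma den_mod m a b va vb : D m a va -> D m b vb -> 0 < vb -> vb <= M ->
  va * vb <= M -> D m (eMod a b) (va %% vb).
Proof.
move=> Da Db b0 bM abM; apply: (den_let2 Da Db).
have aM : va <= M by apply: leq_trans abM; rewrite leq_pmulr.
have -> : va %% vb = va - va %/ vb * vb by rewrite {2}(divn_eq va vb) addKn.
have qM : va %/ vb * vb <= M by apply: leq_trans aM; exact: leq_divM.
apply: den_sub => //; first exact: den_name.
apply: den_mul => //; last first.
- by apply: leq_trans qM; rewrite leq_pmulr.
- exact: den_name.
- by apply: den_div => //; exact: den_name.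
Qed.

Lemma den_absdiff m a b va vb : D m a va -> D m b vb -> va <= M -> vb <= M ->
  D m (eAbsdiff a b) (absdiff va vb).
Proof.
move=> Da Db aM bM; apply: (den_let2 Da Db); apply: den_add; last by lia.
  by apply: den_sub => //; exact: den_name.
by apply: den_sub => //; exact: den_name.
Qed.

End Library.

(** * The table of reachable states *)

(* With B = n + 1, digit [idx v] of a state is the position of v in S, digit
   [k + idx v] the number of neighbours of v outside S placed before v, and the
   quotient by B^(2k) the total imbalance of the cliques placed so far.  Digit
   [idx v] of a choice [c] for the clique of [x] is the number of its vertices
   placed before v.  Row x of the table, the states reached after the cliques of
   representative < x, starts at x B^(2k+2). *)
Section Spec.
Variables (n k : nat) (inS : nat -> bool) (adj : nat -> nat -> bool).
Local Notation B := n.+1.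

Definition dig (i a : nat) : nat := a %/ B ^ i %% B.
Definition idx (v : nat) : nat := \sum_(u < v) inS u.
Definition theta (v c : nat) : nat := dig (idx v) c.
(** Outside a twin cover adjacency is transitive, so having no smaller neighbour there singles out
    the least vertex of each clique. *)
Definition rep (x : nat) : bool :=
  ~~ inS x && ~~ [exists y : 'I_x, ~~ inS y && adj x y].
Definition csz (x : nat) : nat :=
  \sum_(y < n) (~~ inS y && ((y == x :> nat) || adj x y)).
Definition lft (x c j : nat) : nat :=
  j + \sum_(v < n) (inS v && adj x v && (theta v c <= j)).
Definition rgt (x c j : nat) : nat :=
  (csz x - j.+1) + \sum_(v < n) (inS v && adj x v && (j < theta v c)).
Definition clcost (x c : nat) : nat :=
  \sum_(j < csz x) absdiff (lft x c j) (rgt x c j).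
Definition valid (a x c : nat) : bool :=
  [forall v : 'I_n, inS v ==> ((theta v c <= csz x) &&
    [forall w : 'I_n, (inS w && (theta v a <= theta w a)) ==>
                      (theta v c <= theta w c)])].
Definition wt_sum (x c : nat) : nat :=
  \sum_(v < n) (inS v && adj x v) * (theta v c * B ^ (k + idx v))
  + clcost x c * B ^ (2 * k).
(** The factor [rep x] lets the rows run over all vertices: a vertex that represents no clique
    leaves the state unchanged. *)
Definition wt (x c : nat) : nat := rep x * wt_sum x c.
(** Initial states are arbitrary digit vectors, so two vertices of S may have the same position;
    breaking ties by vertex number makes each vector describe an order. *)
Definition precedes (a u v : nat) : bool :=
  (theta u a < theta v a) || ((theta u a == theta v a) && (u < v)).
Definition lcount (a v : nat) : nat :=
  dig (k + idx v) a + \sum_(u < n) (inS u && adj v u && precedes a u v).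
Definition fin (a : nat) : nat :=
  a %/ B ^ (2 * k) + \sum_(v < n) inS v *
    absdiff (lcount a v) (\sum_(u < n) adj v u - lcount a v).

(** The last clique is undone by subtracting its weight. Validity is tested on the new state [s]:
    weights are multiples of B^k, so the positions of S are the same before and after. *)
Fixpoint reach (x s : nat) : bool :=
  if x is x'.+1 then
    [exists c : 'I_(B ^ k),
      valid s x' c && ((wt x' c <= s) && reach x' (s - wt x' c))]
  else s < B ^ k.

Definition cell_ok (a : nat) : bool :=
  reach (a %/ B ^ (2 * k + 2)) (a %% B ^ (2 * k + 2)).

Lemma dig_le i a : dig i a <= n.
Proof. by rewrite -ltnS ltn_pmod. Qed.

Lemma sum_bool_le m (P : nat -> bool) : \sum_(i < m) P i <= m.
Proof.
rewrite -[leqRHS]card_ord -sum1_card.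
by apply: leq_sum => i _; exact: leq_b1.
Qed.

Lemma csz_le x : csz x <= n.
Proof. exact: (sum_bool_le n (fun y => ~~ inS y && ((y == x) || adj x y))). Qed.

Lemma lft_le x c j : lft x c j <= j + n.
Proof.
rewrite leq_add2l.
exact: (sum_bool_le n (fun v => inS v && adj x v && (theta v c <= j))).
Qed.

Lemma rgt_le x c j : rgt x c j <= 2 * n.
Proof.
have := sum_bool_le n (fun v => inS v && adj x v && (j < theta v c)).
by rewrite /rgt; have := csz_le x; lia.
Qed.

(** A crude bound that asks nothing of [c], because the program computes the cost of invalid choices
    too. *)
Lemma clcost_le x c : clcost x c <= 4 * B ^ 2.
Proof.
apply: (@leq_trans (csz x * (4 * B))).
  rewrite -[csz x in leqRHS]card_ord -sum_nat_const; apply: leq_sum => j _.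
  have := lft_le x c j; have := rgt_le x c j; have := csz_le x; have := ltn_ord j.
  by rewrite /absdiff; lia.
by have := csz_le x; rewrite -mulnn; nia.
Qed.

Hypothesis k_def : k = idx n.

Lemma idx_le v : v <= n -> idx v <= k.
Proof.
move=> vn; rewrite k_def /idx -(subnKC vn) big_split_ord /=.
exact: leq_addr.
Qed.

Lemma k_le : k <= n.
Proof. by rewrite k_def; exact: sum_bool_le. Qed.

Lemma wt_sum_le x c : wt_sum x c <= 5 * B ^ (2 * k + 2).
Proof.
apply: (@leq_trans (n * (n * B ^ (2 * k)) + 4 * B ^ 2 * B ^ (2 * k))); last first.
  rewrite expnD -mulnn; have : 0 < B ^ (2 * k) by rewrite expn_gt0.
  by nia.
apply: leq_add; last by rewrite leq_mul2r clcost_le orbT.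
rewrite -[n in n * (_ * _)]card_ord -sum_nat_const; apply: leq_sum => v _.
rewrite -[leqRHS]mul1n; apply: leq_mul; first exact: leq_b1.
apply: leq_mul; first exact: dig_le.
by apply: leq_pexp2l => //; have := idx_le (ltnW (ltn_ord v)); lia.
Qed.

Lemma wt_le x c : wt x c <= 5 * B ^ (2 * k + 2).
Proof. by rewrite /wt; case: rep; rewrite ?mul0n // mul1n wt_sum_le. Qed.

Lemma lcount_le a v : lcount a v <= 2 * n.
Proof.
have := sum_bool_le n (fun u => inS u && adj v u && precedes a u v).
by rewrite /lcount; have := dig_le (k + idx v) a; lia.
Qed.

(** It covers unreachable states, on which [fin] is evaluated as well, and tells where |t| may be
    truncated. *)
Lemma fin_le a : a < B ^ (2 * k + 2) -> fin a <= 4 * B ^ 2.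
Proof.
move=> la; apply: (@leq_trans (B ^ 2 + n * (3 * n))); last by rewrite -mulnn; nia.
apply: leq_add.
  by apply: ltnW; rewrite ltn_divLR ?expn_gt0 // -expnD addnC.
rewrite -[n in n * (_ * _)]card_ord -sum_nat_const; apply: leq_sum => v _.
rewrite -[leqRHS]mul1n; apply: leq_mul; first exact: leq_b1.
have := lcount_le a v; have := sum_bool_le n (adj v).
by rewrite /absdiff; lia.
Qed.

End Spec.

(* Names: 0 = n, 1 = packed cells, 9 = k, 10 = B^k, 11 = B^(2k+2), 12 = base of
   the table, 13 = state,
   17 = clique representative, 18 = choice, 24 = t,
   25 = table index. *)
Definition eB := Succ (Var 0).
(** Both summands are always evaluated, one of them multiplied by 0. Truncated subtractions keep
    them legal: the exponent is min(a, K) - 2 and the address read is max(a, K). Cell [a] below [K]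
    is the binary digit a - 2 of the packed number. *)
Definition eCell (K : nat) a :=
  Let2 4 a 5 (Cst 0)
    (eAdd (eMul (eLt (Var 4) (Cst K))
             (eMod (eDiv (Var 1) (ePow (Cst 2)
                (eSub (eSub (Var 4) (eSub (Var 4) (Cst K))) (Cst 2)))) (Cst 2)))
          (eMul (eLe (Cst K) (Var 4))
             (Rd (eAdd (Var 4) (eSub (Cst K) (Var 4)))))).
Definition eInS K v := eCell K (eAdd v (Cst 3)).
Definition eAdj K i j :=
  eCell K (eAdd (eAdd (eAdd (Var 0) (Cst 3)) (eMul i (Var 0))) j).
Definition eIdx K v := Let2 4 v 5 (Cst 0) (eSum 6 (Var 4) (eInS K (Var 6))).
Definition eDig i a := eMod (eDiv a (ePow eB i)) eB.
Definition eTheta K v c := eDig (eIdx K v) c.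
Definition eRep K :=
  eMul (eNot (eInS K (Var 17)))
    (eNot (eEx 23 (Var 17)
       (eMul (eNot (eInS K (Var 23))) (eAdj K (Var 17) (Var 23))))).
Definition eCsz K :=
  eSum 23 (Var 0) (eMul (eNot (eInS K (Var 23)))
    (eOr (eEq (Var 23) (Var 17)) (eAdj K (Var 17) (Var 23)))).
Definition eNb K := eMul (eInS K (Var 19)) (eAdj K (Var 17) (Var 19)).
Definition eLft K :=
  eAdd (Var 22) (eSum 19 (Var 0)
    (eMul (eNb K) (eLe (eTheta K (Var 19) (Var 18)) (Var 22)))).
Definition eRgt K :=
  eAdd (eSub (eCsz K) (Succ (Var 22))) (eSum 19 (Var 0)
    (eMul (eNb K) (eLt (Var 22) (eTheta K (Var 19) (Var 18))))).
Definition eCost K := eSum 22 (eCsz K) (eAbsdiff (eLft K) (eRgt K)).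
Definition eValid K :=
  eAll 19 (Var 0) (eImp (eInS K (Var 19))
    (eMul (eLe (eTheta K (Var 19) (Var 18)) (eCsz K))
       (eAll 20 (Var 0) (eImp
          (eMul (eInS K (Var 20))
             (eLe (eTheta K (Var 19) (Var 13)) (eTheta K (Var 20) (Var 13))))
          (eLe (eTheta K (Var 19) (Var 18)) (eTheta K (Var 20) (Var 18))))))).
Definition e2k := eAdd (Var 9) (Var 9).
Definition eWt K :=
  eMul (eRep K)
    (eAdd (eSum 19 (Var 0) (eMul (eNb K)
             (eMul (eTheta K (Var 19) (Var 18))
                   (ePow eB (eAdd (Var 9) (eIdx K (Var 19)))))))
          (eMul (eCost K) (ePow eB e2k))).
(** On an index of the first row the second alternative is evaluated too: [Pred] turns the quotient
    0 into the vertex 0, and the truncated subtraction keeps the address inside the table. *)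
Definition eStep K :=
  eOr (eLt (Var 25) (Var 10))
    (eMul (eLe (Var 11) (Var 25))
      (Let2 17 (Pred (eDiv (Var 25) (Var 11))) 13 (eMod (Var 25) (Var 11))
        (eEx 18 (Var 10) (eMul (eValid K)
          (eMul (eLe (eWt K) (Var 13))
            (eLt (Cst 0)
              (Rd (eAdd (Var 12) (eSub (Var 25) (eAdd (Var 11) (eWt K))))))))))).
Definition ePrecedes K :=
  eOr (eLt (eTheta K (Var 20) (Var 13)) (eTheta K (Var 19) (Var 13)))
      (eMul (eEq (eTheta K (Var 20) (Var 13)) (eTheta K (Var 19) (Var 13)))
            (eLt (Var 20) (Var 19))).
Definition eLcount K :=
  eAdd (eDig (eAdd (Var 9) (eIdx K (Var 19))) (Var 13))
    (eSum 20 (Var 0) (eMul (eMul (eInS K (Var 20)) (eAdj K (Var 19) (Var 20)))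
                           (ePrecedes K))).
Definition eFin K :=
  eAdd (eDiv (Var 13) (ePow eB e2k))
    (eSum 19 (Var 0) (eMul (eInS K (Var 19))
      (eAbsdiff (eLcount K)
         (eSub (eSum 20 (Var 0) (eAdj K (Var 19) (Var 20))) (eLcount K))))).
Definition eResult K :=
  eMul (eNot (eMod (Var 1) (Cst 2)))
    (eEx 13 (Var 11)
      (eMul (eLt (Cst 0)
               (Rd (eAdd (eAdd (Var 12) (eMul (Var 0) (Var 11))) (Var 13))))
            (eLe (eFin K) (Var 24)))).

(** * Values of the expressions of the algorithm *)

Section Denotation.
Variables (K M n packed : nat) (orig : memory).
Local Notation B := n.+1.
Local Notation tb := (K + n + n * n).
Let inS v := orig (3 + v) == 1.
Let adj i j := orig (3 + n + i * n + j) == 1.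
Let k := idx inS n.
Local Notation D := (den K M).

Hypothesis nvK : nv <= K.
Hypothesis boundM : forall j, j <= 4 * k + 8 -> (100 + K) * B ^ j <= M.
Hypothesis M2K : 2 ^ K <= M.
Hypothesis Mpacked : packed * 2 ^ K <= M.
Hypothesis orig_bool : forall a, 3 <= a -> orig a <= 1.
Hypothesis packed_sign : packed %% 2 = orig 1.
Hypothesis packed_cell :
  forall a, 3 <= a -> a < K -> packed %/ 2 ^ (a - 2) %% 2 = orig a.

(** [iok_bool] covers the table and everything beyond: reads happen before their guards are known to
    hold, and the value read still has to be small enough to compare. *)
Record input_ok (m : memory) : Prop := InputOk {
  iok_n : m 0 = n;
  iok_packed : m 1 = packed;
  iok_cell : forall a, K <= a -> a < tb -> m a = orig a;
  iok_bool : forall a, K <= a -> m a <= 1 }.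

Record globals_ok (m : memory) : Prop := GlobalsOk {
  gok_input : input_ok m;
  gok_k : m 9 = k;
  gok_Bk : m 10 = B ^ k;
  gok_Big : m 11 = B ^ (2 * k + 2);
  gok_tb : m 12 = tb }.

Lemma input_ok_upd m x v :
  (x < nv) && (x \notin [:: 0; 1]) -> input_ok m -> input_ok (upd m x v).
Proof.
clear boundM M2K Mpacked orig_bool packed_sign packed_cell.
rewrite !inE => /andP[xnv xn] [n0 p cell b]; split.
- by upd_simpl.
- by upd_simpl.
- by move=> a Ka atb; rewrite -cell //; upd_simpl.
- by move=> a Ka; have := b a Ka; upd_simpl.
Qed.

Lemma globals_ok_upd m x v :
  (x < nv) && (x \notin [:: 0; 1; 9; 10; 11; 12]) ->
  globals_ok m -> globals_ok (upd m x v).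
Proof.
clear boundM M2K Mpacked orig_bool packed_sign packed_cell.
rewrite !inE => /andP[xnv xn] [i kk b1 b2 t]; split; try by upd_simpl.
by apply: input_ok_upd => //; rewrite !inE; lia.
Qed.

Lemma M_gt0 : 0 < M.
Proof. by apply: leq_trans M2K; rewrite expn_gt0. Qed.

Lemma le_M v c j : v <= c * B ^ j -> c <= 100 + K -> j <= 4 * k + 8 -> v <= M.
Proof.
move=> vc cK jk; apply: leq_trans (boundM jk); apply: leq_trans vc _.
by rewrite leq_mul2r cK orbT.
Qed.

Lemma le_M1 v : v <= (100 + K) * (B * B) -> v <= M.
Proof. by move=> vB; apply: (@le_M _ (100 + K) 2) => //; rewrite ?expnS ?muln1 //; lia. Qed.

Lemma bool_M (b : bool) : b <= M.
Proof. exact: leq_trans (leq_b1 b) M_gt0. Qed.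

Lemma inSE v : inS v = orig (3 + v) :> nat.
Proof. by have := @orig_bool (3 + v) isT; rewrite /inS; case: orig => [|[]]. Qed.

Lemma adjE i j : adj i j = orig (3 + n + i * n + j) :> nat.
Proof.
have := @orig_bool (3 + n + i * n + j); rewrite /adj -!addnA => /(_ isT).
by case: orig => [|[]].
Qed.

Lemma den_cell m a v : input_ok m -> D m a v -> 3 <= v -> v < tb ->
  D m (eCell K a) (orig v).
Proof.
move=> im Da v3 vtb; have [n0 p cell b] := im.
have vM : v <= M by apply: le_M1; nia.
have KM : K <= M by apply: le_M1; nia.
have M0 := M_gt0.
apply: (den_let2 Da (den_cst _ _ _ _)).
set m' := upd _ 5 0; have m'4 : m' 4 = v by [].
have m'1 : m' 1 = packed by [].
have m'h r : K <= r -> m' r = m r by move=> Kr; rewrite /m' /upd !ifN //; lia.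
clearbody m'.
have dV : D m' (Var 4) v by exact: den_name.
have dK : D m' (Cst K) K by exact: den_cst.
set q := packed %/ 2 ^ (v - (v - K) - 2) %% 2.
have -> : orig v = (v < K) * q + (K <= v) * m' (v + (K - v)).
  rewrite /q; case: (ltnP v K) => vK.
    rewrite mul0n addn0 mul1n -(packed_cell v3 vK).
    by rewrite (_ : v - (v - K) = v) //; lia.
  rewrite mul0n add0n mul1n (_ : v + (K - v) = v); last by lia.
  by rewrite m'h ?cell.
have powK : 2 ^ (v - (v - K) - 2) <= 2 ^ K by apply: leq_pexp2l => //; lia.
have b' : m' (v + (K - v)) <= 1.
  by rewrite m'h ?b //; lia.
have q1 : q <= 1 by rewrite -ltnS ltn_pmod.
have ? : 2 <= M by apply: le_M1; nia.
apply: den_add.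
- apply: den_mul; [exact: (den_lt M_gt0)| |exact: bool_M|by lia].
  have dpow : D m' (ePow (Cst 2) (eSub (eSub (Var 4) (eSub (Var 4) (Cst K))) (Cst 2)))
      (2 ^ (v - (v - K) - 2)).
    apply: (den_pow M_gt0) => //; [exact: den_cst| |by lia|by lia].
    apply: den_sub => //; [|exact: den_cst].
    by apply: den_sub => //; [exact: den_sub|by lia].
  have pM : packed * 2 ^ (v - (v - K) - 2) <= M.
    by apply: leq_trans Mpacked; rewrite leq_mul2l powK orbT.
  apply: (den_mod M0); [|exact: den_cst|by []|by lia|].
    by apply: (den_div M_gt0) => //; [exact: den_name|rewrite expn_gt0].
  apply: leq_trans Mpacked; apply: leq_mul; first exact: leq_div.
  by rewrite -{1}[2]expn1; apply: leq_pexp2l => //; lia.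
- apply: den_mul; [exact: (den_le M_gt0)| |exact: bool_M|by lia].
  apply: den_rd; [|by lia].
  by apply: den_add => //; [exact: den_sub|by lia].
- by apply: leq_trans (_ : 1 <= M) => //; case: (K <= v) => //; rewrite mul1n.
Qed.

Lemma den_inS m a v : input_ok m -> D m a v -> v <= n -> D m (eInS K a) (inS v).
Proof.
move=> im Da vn; rewrite inSE addnC; apply: den_cell => //; [|lia|by nia].
by apply: den_add => //; [exact: den_cst|apply: le_M1; nia].
Qed.

Lemma den_adj m a b i j : input_ok m -> D m a i -> D m b j -> i < n -> j < n ->
  D m (eAdj K a b) (adj i j).
Proof.
move=> im Da Db lin ljn; rewrite adjE.
have n0 := iok_n im.
apply: den_cell => //; [|nia].
have Mn : n <= M by apply: le_M1; nia.
have M3 : 3 <= M by apply: le_M1; nia.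
apply: den_add => //; [|by lia].
apply: den_add => //; [| |by apply: le_M1; nia].
- by rewrite addnC; apply: den_add => //; [exact: den_name|exact: den_cst].
- by apply: den_mul => //; [exact: den_name|lia].
Qed.

Lemma den_idx m a v : input_ok m -> D m a v -> v <= n -> D m (eIdx K a) (idx inS v).
Proof.
move=> im Da vn; apply: (den_let2 Da (den_cst _ _ _ _)).
apply: (den_sum (f := fun u => inS u)) => //; [exact: den_name|by apply: le_M1; nia| |].
  move=> i acc iv; apply: den_inS; [|exact: den_name|by lia].
  by do 4?apply: input_ok_upd => //.
by move=> i _; exact: bool_M.
Qed.

Lemma k_le_n : k <= n. Proof. exact: k_le. Qed.

Lemma den_dig m i a vi va : input_ok m -> D m i vi -> D m a va ->
  vi <= 2 * k -> va <= B ^ (2 * k + 3) -> D m (eDig i a) (dig n vi va).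
Proof.
move=> im Di Da ik aB; have n0 := iok_n im; have kn := k_le_n.
have dB : D m eB B by apply: den_succ; exact: den_name.
have BM : B ^ vi <= M by apply: (@le_M _ 1 vi); lia.
have B0 : 0 < B ^ vi by rewrite expn_gt0.
have dp : D m (ePow eB i) (B ^ vi) by apply: (den_pow M_gt0) => //; apply: le_M1; nia.
have H1 : va * B ^ vi <= M.
  apply: (@le_M _ 1 (2 * k + 3 + vi)); [|by lia|by lia].
  by rewrite mul1n expnD leq_mul2r aB orbT.
apply: (den_mod M_gt0) => //; [exact: (den_div M_gt0)|by apply: le_M1; nia|].
apply: (@le_M _ 1 (2 * k + 3 + 1)); [|by lia|by lia].
rewrite mul1n expnD expn1 leq_mul2r; apply/orP; right.
exact: leq_trans (leq_div _ _) aB.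
Qed.

Lemma den_theta m a c v vc : input_ok m -> D m a v -> D m c vc -> v < n ->
  vc <= B ^ (2 * k + 3) -> D m (eTheta K a c) (theta n inS v vc).
Proof.
move=> im Da Dc vn cB; apply: den_dig => //; first by apply: den_idx => //; exact: ltnW.
by have := @idx_le n k inS erefl v (ltnW vn); lia.
Qed.

Ltac gok := repeat (apply: globals_ok_upd; [by []|]); assumption.
Ltac iok := repeat (apply: input_ok_upd; [by []|]);
  first [assumption | by apply: gok_input | apply: gok_input; gok].

Lemma n_M : n <= M. Proof. by apply: le_M1; nia. Qed.

Lemma den_n m : input_ok m -> D m (Var 0) n.
Proof. by move=> im; apply: den_name; exact: iok_n. Qed.

(** The bound [n.-1] instead of [x < n] admits x = 0 in the empty graph, where the discarded
    alternative of [eStep] is still evaluated. *)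
Lemma den_rep m x : input_ok m -> m 17 = x -> x <= n.-1 ->
  D m (eRep K) (rep inS adj x).
Proof.
move=> im mx xn; have nM := n_M.
apply: (den_and M_gt0); apply: (den_not M_gt0).
  by apply: den_inS => //; [exact: den_name|lia].
apply: (den_ex M_gt0 (P := fun y => ~~ inS y && adj x y)) => //.
- exact: den_name.
- by lia.
- move=> i acc lix; apply: (den_and M_gt0).
    by apply/(den_not M_gt0)/den_inS; [iok|exact: den_name|lia].
  by apply: den_adj; [iok|exact: den_name|exact: den_name|lia|lia].
Qed.

Lemma den_csz m x : input_ok m -> m 17 = x -> x <= n.-1 ->
  D m (eCsz K) (csz n inS adj x).
Proof.
move=> im mx xn; have nM := n_M.
apply: (den_sum (f := fun y => ~~ inS y && ((y == x) || adj x y))) => //.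
- exact: den_n.
- move=> i acc lin; apply: (den_and M_gt0).
    by apply/(den_not M_gt0)/den_inS; [iok|exact: den_name|exact: ltnW].
  apply: (den_or M_gt0).
    by apply: (den_eqn M_gt0); [exact: den_name|exact: den_name|lia|lia].
  by apply: den_adj; [iok|exact: den_name|exact: den_name|lia|].
- by move=> i _; exact: bool_M.
Qed.

Lemma den_nb m x v : input_ok m -> m 17 = x -> m 19 = v -> x <= n.-1 -> v < n ->
  D m (eNb K) (inS v && adj x v).
Proof.
move=> im mx mv xn vn; apply: (den_and M_gt0).
  by apply: den_inS; [|exact: den_name|exact: ltnW].
by apply: den_adj; [|exact: den_name|exact: den_name|lia|].
Qed.

Let Bk2 : B ^ k <= B ^ (2 * k + 3).
Proof. by apply: leq_pexp2l => //; lia. Qed.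

Lemma den_lft m x c j : input_ok m -> m 17 = x -> m 18 = c -> m 22 = j ->
  x <= n.-1 -> c < B ^ k -> j <= n -> D m (eLft K) (lft n inS adj x c j).
Proof.
move=> im mx mc mj xn cB jn; have nM := n_M.
apply: den_add; [exact: den_name| |]; last first.
  apply: leq_trans nM.
  exact: (sum_bool_le n (fun v => inS v && adj x v && (theta n inS v c <= j))).
apply: (den_sum (f := fun v => inS v && adj x v && (theta n inS v c <= j))) => //.
- exact: den_n.
- move=> i acc lin; apply: (den_and M_gt0); first by apply: den_nb => //; iok.
  apply: (den_le M_gt0); [|exact: den_name|by apply: leq_trans nM; exact: dig_le|by lia].
  by apply: den_theta; [iok|exact: den_name|exact: den_name|by []|lia].
- by move=> i _; exact: bool_M.
Qed.

Lemma den_rgt m x c j : input_ok m -> m 17 = x -> m 18 = c -> m 22 = j ->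
  x <= n.-1 -> c < B ^ k -> j < n -> D m (eRgt K) (rgt n inS adj x c j).
Proof.
move=> im mx mc mj xn cB jn; have nM := n_M.
apply: den_add; last first.
- apply: leq_trans nM.
  exact: (sum_bool_le n (fun v => inS v && adj x v && (j < theta n inS v c))).
- apply: (den_sum (f := fun v => inS v && adj x v && (j < theta n inS v c))) => //.
  + exact: den_n.
  + move=> i acc lin; apply: (den_and M_gt0); first by apply: den_nb => //; iok.
    apply: (den_lt M_gt0); [exact: den_name| |by lia|by apply: leq_trans nM; exact: dig_le].
    by apply: den_theta; [iok|exact: den_name|exact: den_name|by []|lia].
  + by move=> i _; exact: bool_M.
- apply: den_sub; [exact: den_csz|by apply: den_succ; exact: den_name|by lia].
Qed.

Lemma den_cost m x c : input_ok m -> m 17 = x -> m 18 = c ->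
  x <= n.-1 -> c < B ^ k -> D m (eCost K) (clcost n inS adj x c).
Proof.
move=> im mx mc xn cB; have nM := n_M; have cn := csz_le n inS adj x.
have M4 : 4 * B <= M by apply: le_M1; nia.
have lM j : j <= n -> lft n inS adj x c j <= M.
  by have := lft_le n inS adj x c j; lia.
have rM j : rgt n inS adj x c j <= M.
  by have := rgt_le n inS adj x c j; lia.
apply: (den_sum (f := fun j =>
    absdiff (lft n inS adj x c j) (rgt n inS adj x c j))) => //.
- exact: den_csz.
- by lia.
- move=> j acc jc; apply: (den_absdiff M_gt0); [| |by apply: lM; lia|by []].
    by apply: den_lft => //; [iok|lia].
  by apply: den_rgt => //; [iok|lia].
- move=> j jc; have := lft_le n inS adj x c j; have := rgt_le n inS adj x c j.
  by rewrite /absdiff; lia.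
Qed.

Lemma den_valid m a x c : input_ok m -> m 13 = a -> m 17 = x -> m 18 = c ->
  x <= n.-1 -> c < B ^ k -> a < B ^ (2 * k + 3) ->
  D m (eValid K) (valid n inS adj a x c).
Proof.
move=> im ma mx mc xn cB aB; have nM := n_M.
have tM v u : theta n inS v u <= M by apply: leq_trans nM; exact: dig_le.
have dt m' y z : input_ok m' -> m' y < n -> m' z < B ^ (2 * k + 3) ->
    D m' (eTheta K (Var y) (Var z)) (theta n inS (m' y) (m' z)).
  by move=> im' yn zB; apply: den_theta => //; [exact: den_var|exact: den_var|exact: ltnW].
apply: (den_all M_gt0 (P := fun v => inS v ==> ((theta n inS v c <= csz n inS adj x) &&
    [forall w : 'I_n, (inS w && (theta n inS v a <= theta n inS w a)) ==>
                      (theta n inS v c <= theta n inS w c)]))) => //.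
  exact: den_n.
move=> v acc vn; apply: (den_imp M_gt0).
  by apply: den_inS; [iok|exact: den_name|exact: ltnW].
apply: (den_and M_gt0).
  apply: (den_le M_gt0) => //; last by apply: leq_trans nM; exact: csz_le.
    by rewrite -mc; apply: dt; [iok| |rewrite /upd /= mc; lia].
  by apply: den_csz => //; iok.
apply: (den_all M_gt0 (P := fun w => (inS w && (theta n inS v a <= theta n inS w a)) ==>
                      (theta n inS v c <= theta n inS w c))) => //.
  by apply: den_n; iok.
move=> w acc' wn; apply: (den_imp M_gt0).
  apply: (den_and M_gt0); first by apply: den_inS; [iok|exact: den_name|exact: ltnW].
  by rewrite -ma; apply: (den_le M_gt0) => //; apply: dt; (try iok) => //=; rewrite /upd /= ma.
by rewrite -mc; apply: (den_le M_gt0) => //; apply: dt; (try iok) => //=; rewrite /upd /= mc; lia.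
Qed.

Lemma leq_dig2 v : v < n -> k + idx inS v <= 2 * k.
Proof. by move=> vn; have := @idx_le n k inS erefl v (ltnW vn); lia. Qed.

Lemma den_B m : input_ok m -> D m eB B.
Proof. by move=> im; apply: den_succ; exact: den_n. Qed.

Lemma den_powB m a i : input_ok m -> D m a i -> i <= 2 * k -> D m (ePow eB a) (B ^ i).
Proof.
move=> im Da ik; apply: (den_pow M_gt0) => //; first exact: den_B.
  by have := k_le_n; have := n_M; have : 3 * n <= M; [apply: le_M1; nia|lia].
by apply: (@le_M _ 1 i); lia.
Qed.

Lemma den_2k m : globals_ok m -> D m e2k (2 * k).
Proof.
case=> _ mk _ _ _; rewrite mul2n -addnn.
by apply: den_add; try exact: den_name; have := k_le_n; have := n_M; lia.
Qed.

Lemma den_wt m x c : globals_ok m -> m 17 = x -> m 18 = c ->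
  x <= n.-1 -> c < B ^ k -> D m (eWt K) (wt n k inS adj x c).
Proof.
move=> gm mx mc xn cB; have nM := n_M; have im := gok_input gm.
have BM j : j <= 2 * k -> B ^ j <= M by move=> jk; apply: (@le_M _ 1 j); lia.
have tBM v : v < n -> theta n inS v c * B ^ (k + idx inS v) <= M.
  move=> vn; apply: (@le_M _ 1 (1 + (k + idx inS v))); [|by lia|].
    by rewrite mul1n [leqRHS]expnD leq_mul2r expn1 ltnW ?orbT // ltnS dig_le.
  by have := leq_dig2 vn; lia.
have wM : wt_sum n k inS adj x c <= M.
  apply: (@le_M _ 5 (2 * k + 2)); [|by lia|by lia].
  exact: (@wt_sum_le n k inS adj erefl).
apply: den_mul; [exact: den_rep| |exact: bool_M|by []].
have clM : clcost n inS adj x c <= M.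
  apply: (@le_M _ 4 2); [|by lia|by lia].
  exact: clcost_le.
apply: den_add; last by apply: leq_trans wM; exact: leq_addl.
- apply: (den_sum (f := fun v =>
      (inS v && adj x v) * (theta n inS v c * B ^ (k + idx inS v)))) => //.
  + exact: den_n.
  + move=> v acc vn; apply: den_mul; [by apply: den_nb => //; iok| |exact: bool_M|exact: tBM].
    apply: den_mul.
    * by apply: den_theta; [iok|exact: den_name|exact: den_name|by []|lia].
    * apply: den_powB; [iok| |exact: leq_dig2].
      apply: den_add; first by apply: den_name; exact: (gok_k gm).
        by apply: den_idx; [iok|exact: den_name|exact: ltnW].
      by have := leq_dig2 vn; have := k_le_n; lia.
    * by apply: leq_trans nM; exact: dig_le.
    * by apply: BM; exact: leq_dig2.
  + move=> v vn; apply: leq_trans (tBM v vn).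
    by case: (_ && _); rewrite ?mul1n.
- apply: den_mul => //; [exact: den_cost| |exact: BM].
  by apply: den_powB => //; exact: den_2k.
Qed.

Lemma den_step m a : globals_ok m -> m 25 = a -> a < B ^ (2 * k + 3) ->
  (forall b, b < a -> m (tb + b) = cell_ok n k inS adj b) ->
  D m (eStep K) (cell_ok n k inS adj a).
Proof.
move=> gm ma aB tab; have [im mk mBk mBig mtb] := gm; have nM := n_M.
set Big := B ^ (2 * k + 2) in mBig *.
have Big0 : 0 < Big by rewrite expn_gt0.
have BkBig : B ^ k <= Big by apply: leq_pexp2l => //; lia.
have BBig : B ^ (2 * k + 3) = B * Big by rewrite -expnS addnS.
have M7 : 7 * Big <= M by apply: (@le_M _ 7 (2 * k + 2)); lia.
have aM : a <= M by apply: (@le_M _ 1 (2 * k + 3)); lia.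
have aBigM : a * Big <= M.
  apply: (@le_M _ 1 (2 * k + 3 + (2 * k + 2))); [|by lia|by lia].
  by rewrite mul1n expnD; apply: leq_mul => //; exact: ltnW.
set s := a %% Big; set x := (a %/ Big).-1.
pose w c := wt n k inS adj x c.
have wB c : w c <= 5 * Big by exact: (@wt_le n k inS adj erefl).
have sB : s < Big by rewrite ltn_pmod.
pose m1 := upd (upd m 17 x) 13 s.
(* In row x + 1, subtracting [Big + w c] from the index moves to row x and state [s - w c]. That
   cell precedes [a], so it is already filled. In row 0 only the first alternative can hold, and in
   later rows only the second. *)
have -> : cell_ok n k inS adj a = (a < B ^ k) || ((Big <= a) &&
    [exists c : 'I_(B ^ k), valid n inS adj s x c && ((w c <= s) &&
       (0 < m (tb + (a - (Big + w c)))))]).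
  rewrite /cell_ok -/Big -/s; case: (ltnP a Big) => aBig.
    by rewrite /= orbF divn_small //= /s modn_small.
  have -> : a < B ^ k = false by lia.
  have q0 : 0 < a %/ Big by rewrite divn_gt0.
  have qx : a %/ Big = x.+1 by rewrite /x prednK.
  rewrite qx /=; apply: eq_existsb => c; congr (_ && _).
  rewrite -/(w c); case: (leqP (w c) s) => //= ws.
  have ea : a = x.+1 * Big + s by rewrite -qx {1}(divn_eq a Big).
  have eb : a - (Big + w c) = x * Big + (s - w c) by rewrite ea mulSn; lia.
  rewrite tab; last by lia.
  rewrite eb /cell_ok -/Big divnMDl // divn_small ?addn0; last by lia.
  by rewrite modnMDl modn_small; [case: reach|lia].
have d25 m' : m' 25 = a -> D m' (Var 25) a by exact: den_name.
have d11 m' : m' 11 = Big -> D m' (Var 11) Big by exact: den_name.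
apply: (den_or M_gt0).
  by apply: (den_lt M_gt0) => //; [exact: d25|exact: den_name|lia].
apply: (den_and M_gt0).
  by apply: (den_le M_gt0); [exact: d11|exact: d25|lia|].
apply: (den_let2 (va := x) (vb := s)).
- by apply: den_pred; apply: (den_div M_gt0); [exact: d25|exact: d11| |].
- by apply: (den_mod M_gt0); [exact: d25|exact: d11| |lia|].
rewrite -/m1.
have gm1 : globals_ok m1 by rewrite /m1; gok.
have m117 : m1 17 = x by [].
have m113 : m1 13 = s by [].
have m125 : m1 25 = a by rewrite -ma.
have m1h r : K <= r -> m1 r = m r by move=> Kr; rewrite /m1 /upd !ifN //; lia.
clearbody m1; have [im1 mk1 mBk1 mBig1 mtb1] := gm1.
have xn : x <= n.-1.
  have : a %/ Big < B by rewrite ltn_divLR // -BBig.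
  by rewrite /x; lia.
apply: (den_ex M_gt0 (P := fun c => valid n inS adj s x c && ((w c <= s) &&
       (0 < m (tb + (a - (Big + w c))))))) => //; [exact: den_name|by lia|].
move=> c acc cB; set m2 := upd (upd m1 18 c) 8 acc.
have gm2 : globals_ok m2 by rewrite /m2; gok.
have m217 : m2 17 = x by rewrite -m117.
have m213 : m2 13 = s by rewrite -m113.
have m225 : m2 25 = a by rewrite -m125.
have m218 : m2 18 = c by [].
have m2h r : K <= r -> m2 r = m r by move=> Kr; rewrite /m2 /upd !ifN ?m1h //; lia.
clearbody m2; have [im2 mk2 mBk2 mBig2 mtb2] := gm2.
have wM : w c <= M by have := wB c; lia.
have dw : D m2 (eWt K) (w c) by exact: den_wt.
apply: (den_and M_gt0); first by apply: den_valid => //; lia.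
apply: (den_and M_gt0).
  by apply: (den_le M_gt0) => //; [exact: den_name|lia].
have addrK : K <= tb + (a - (Big + w c)) by lia.
rewrite -m2h //; apply: (den_lt M_gt0) => //; [exact: den_cst| |]; last first.
  by apply: leq_trans M_gt0; apply: iok_bool => //; lia.
apply: den_rd => //; apply: den_add; [exact: den_name| |by lia].
apply: den_sub; [exact: d25| |by have := wB c; lia].
by apply: den_add => //; exact: d11.
Qed.

Lemma den_precedes m a u v : input_ok m -> m 13 = a -> m 20 = u -> m 19 = v ->
  u < n -> v < n -> a <= B ^ (2 * k + 3) -> D m (ePrecedes K) (precedes n inS a u v).
Proof.
move=> im ma mu mv un vn aB; have nM := n_M.
have tM w : theta n inS w a <= M by apply: leq_trans nM; exact: dig_le.
have dt y : m y < n -> D m (eTheta K (Var y) (Var 13)) (theta n inS (m y) a).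
  by move=> yn; apply: den_theta => //; [exact: den_var|exact: den_name].
have d19 : D m (eTheta K (Var 19) (Var 13)) (theta n inS v a) by rewrite -mv; apply: dt; rewrite mv.
have d20 : D m (eTheta K (Var 20) (Var 13)) (theta n inS u a) by rewrite -mu; apply: dt; rewrite mu.
apply: (den_or M_gt0); first exact: (den_lt M_gt0).
apply: (den_and M_gt0); first exact: (den_eqn M_gt0).
by apply: (den_lt M_gt0); [exact: den_name|exact: den_name|lia|lia].
Qed.

Lemma den_lcount m a v : globals_ok m -> m 13 = a -> m 19 = v ->
  v < n -> a <= B ^ (2 * k + 3) -> D m (eLcount K) (lcount n k inS adj a v).
Proof.
move=> gm ma mv vn aB; have nM := n_M; have im := gok_input gm.
pose P u := inS u && adj v u && precedes n inS a u v.
apply: den_add; last by apply: leq_trans nM; exact: (sum_bool_le n P).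
- apply: den_dig => //; last exact: leq_dig2.
    apply: den_add; first by apply: den_name; exact: gok_k.
      by apply: den_idx; [|exact: den_name|exact: ltnW].
    by have := leq_dig2 vn; have := k_le_n; lia.
  exact: den_name.
- apply: (den_sum (f := P)) => //; [exact: den_n| |by move=> *; exact: bool_M].
  move=> u acc un; apply: (den_and M_gt0); last by apply: den_precedes => //; iok.
  apply: (den_and M_gt0); first by apply: den_inS; [iok|exact: den_name|exact: ltnW].
  by apply: den_adj; [iok|exact: den_name|exact: den_name|lia|].
Qed.

Lemma den_fin m a : globals_ok m -> m 13 = a -> a < B ^ (2 * k + 2) ->
  D m (eFin K) (fin n k inS adj a).
Proof.
move=> gm ma aB; have nM := n_M; have im := gok_input gm.
have aB3 : a <= B ^ (2 * k + 3).
  by apply: leq_trans (ltnW aB) _; apply: leq_pexp2l => //; lia.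
pose L v := lcount n k inS adj a v; pose R v := \sum_(u < n) adj v u - L v.
have n3M : 4 * n <= M by apply: le_M1; nia.
have LM v : L v <= 2 * n by exact: lcount_le.
have RM v : R v <= n by apply: leq_trans (leq_subr _ _) _; exact: sum_bool_le.
have fM : fin n k inS adj a <= M.
  by apply: (@le_M _ 4 2); [exact: fin_le|lia|lia].
apply: den_add; last by apply: leq_trans fM; exact: leq_addl.
- apply: (den_div M_gt0); [exact: den_name| |by rewrite expn_gt0|].
    by apply: den_powB => //; exact: den_2k.
  apply: (@le_M _ 1 (2 * k + 2 + 2 * k)); [|by lia|by lia].
  by rewrite mul1n expnD leq_mul2r ltnW ?orbT.
- apply: (den_sum (f := fun v => inS v * absdiff (L v) (R v))) => //.
  + exact: den_n.
  + move=> v acc vn; have lM := LM v; have rM := RM v.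
    have dL : D (upd (upd m 19 v) 8 acc) (eLcount K) (L v).
      by apply: den_lcount => //; gok.
    apply: den_mul; [by apply: den_inS; [iok|exact: den_name|exact: ltnW]| |exact: bool_M|].
      apply: (den_absdiff M_gt0) => //; [|by lia|by lia].
      apply: den_sub => //; last by lia.
      apply: (den_sum (f := fun u => adj v u)) => //; [by apply: den_n; iok| |by move=> *; exact: bool_M].
      by move=> u acc' un; apply: den_adj; [iok|exact: den_name|exact: den_name|lia|].
    by rewrite /absdiff; lia.
  + move=> v vn; have := LM v; have := RM v; rewrite /absdiff.
    by case: (inS v); lia.
Qed.

Lemma den_result m t : globals_ok m -> m 24 = t -> t <= M ->
  (forall b, b < B ^ (2 * k + 3) -> m (tb + b) = cell_ok n k inS adj b) ->
  D m (eResult K) ((orig 1 == 0) && [exists s : 'I_(B ^ (2 * k + 2)),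
    cell_ok n k inS adj (n * B ^ (2 * k + 2) + s) && (fin n k inS adj s <= t)]).
Proof.
move=> gm mt tM tab; have nM := n_M; have [im mk mBk mBig mtb] := gm.
set Big := B ^ (2 * k + 2) in mBig *.
have BBig : B ^ (2 * k + 3) = B * Big by rewrite -expnS addnS.
have BigM : (100 + K) * Big <= M by apply: boundM; lia.
have nBigM : n * Big <= M by apply: (@le_M _ 1 (2 * k + 3)); [rewrite BBig; nia|lia|lia].
have M4 : 4 <= M by apply: le_M1; nia.
apply: (den_and M_gt0).
  (* The sign of t is the lowest binary digit of the packed number. *)
  rewrite -packed_sign; apply: (den_is0 (M := M)); last first.
    by apply: leq_trans (_ : 2 <= M); [exact/ltnW/ltn_pmod|lia].
  apply: (den_mod M_gt0); [|exact: den_cst|by []|by lia|].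
    by apply: den_name; exact: iok_packed.
  apply: leq_trans Mpacked; rewrite leq_mul2l -{1}[2]expn1.
  by rewrite leq_pexp2l ?orbT //; lia.
have P s : s < Big -> cell_ok n k inS adj (n * Big + s) =
    (0 < m (tb + n * Big + s)).
  by move=> sB; rewrite -addnA tab ?BBig ?mulSn; [case: cell_ok|lia].
have -> : [exists s : 'I_Big, cell_ok n k inS adj (n * Big + s) &&
      (fin n k inS adj s <= t)] =
    [exists s : 'I_Big, (0 < m (tb + n * Big + s)) && (fin n k inS adj s <= t)].
  by apply: eq_existsb => s; rewrite P.
apply: (den_ex M_gt0 (P := fun s => (0 < m (tb + n * Big + s)) &&
   (fin n k inS adj s <= t))) => //; [exact: den_name|by nia|].
move=> s acc sB; set m2 := upd (upd m 13 s) 8 acc.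
have gm2 : globals_ok m2 by rewrite /m2; gok.
have m213 : m2 13 = s by [].
have m224 : m2 24 = t by [].
have m2h r : K <= r -> m2 r = m r by move=> Kr; rewrite /m2 /upd !ifN //; lia.
clearbody m2; have [im2 mk2 mBk2 mBig2 mtb2] := gm2.
apply: (den_and M_gt0); last first.
  apply: (den_le M_gt0); [exact: den_fin|exact: den_name| |by []].
  by apply: (@le_M _ 4 2); [exact: fin_le|lia|lia].
have addrK : K <= tb + n * Big + s by lia.
rewrite -m2h //; apply: (den_lt M_gt0) => //; [exact: den_cst| |]; last first.
  by apply: leq_trans M_gt0; exact: iok_bool.
apply: den_rd => //; apply: den_add; [|exact: den_name|by nia].
apply: den_add; [exact: den_name| |by []].
by apply: den_mul; [exact: den_n|exact: den_name|by []|nia].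
Qed.

End Denotation.

(** * The complete program and its run *)

Fixpoint seqn (j : nat) (f : nat -> cmd) : cmd :=
  if j is j'.+1 then Seq (seqn j' f) (f j') else Skip.

Definition assign (x : nat) (e : exp) : cmd := Seq (compile nv e) (Basic (CPY x nv)).

(* The input bits stored in registers 1, 3, ..., K - 1 become the binary digits
   of register 1, which frees the registers below [K]. *)
Definition pack (K : nat) : cmd :=
  Seq (seqn (K - 3) (fun i => Ifnz (3 + i) (repeat_cmd (2 ^ i.+1) (Basic (INC 1)))))
      (seqn (K - 3) (fun i => Basic (DEC (3 + i)))).

(** Units move from register 2 to register 24 for a number of turns set in advance, so the time does
    not depend on |t|. *)
Definition cap : cmd :=
  While 26 (Seq (Ifnz 2 (Seq (Basic (DEC 2)) (Basic (INC 24)))) (Basic (DEC 26))).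

(** Indices increase, so the previous row is complete when a cell consults it. *)
Definition fill (K : nat) : cmd :=
  While 26 (Seq (assign 27 (eStep K)) (Seq (assign 28 (eAdd (Var 12) (Var 25)))
    (Seq (Basic (STORE 28 27)) (Seq (Basic (INC 25)) (Basic (DEC 26)))))).

Definition eTb K := eAdd (eAdd (Cst K) (Var 0)) (eMul (Var 0) (Var 0)).
Definition eBig := ePow eB (eAdd e2k (Cst 2)).
(** This exceeds the bound of [fin_le] on the cost of any state. *)
Definition eCap := eAdd (eMul (Cst 4) (eMul eB eB)) (Cst 1).

Definition main (K : nat) : cmd :=
  Seq (pack K)
  (Seq (assign 9 (eIdx K (Var 0))) (Seq (assign 10 (ePow eB (Var 9)))
  (Seq (assign 11 eBig) (Seq (assign 12 (eTb K)) (Seq (assign 26 eCap) (Seq cap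
  (Seq (assign 26 (eMul eB (Var 11))) (Seq (fill K) (assign 0 (eResult K)))))))))).

Lemma seqn_runs M f (I : nat -> memory -> Prop) p m :
  (forall i m, i < p -> I i m -> runs M (f i) m (I i.+1)) ->
  I 0 m -> runs M (seqn p f) m (I p).
Proof.
elim: p => [|p IH] Hf I0; first exact: runs_skip.
apply: runs_seq; apply: runs_mono (IH _ I0) => [m1 I1|i m1 lip]; first exact: Hf.
by apply: Hf; exact: ltnW.
Qed.

Lemma digit_sum b p (d : nat -> nat) j : (forall i, i < p -> d i < b) -> j < p ->
  (\sum_(i < p) d i * b ^ i) %/ b ^ j %% b = d j.
Proof.
elim: p d j => [//|p IH] d j db jp.
have b0 : 0 < b by apply: leq_ltn_trans (db 0 _).
rewrite big_ord_recl expn0 muln1 /=.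
have -> : \sum_(i < p) d (bump 0 i) * b ^ bump 0 i = b * \sum_(i < p) d i.+1 * b ^ i.
  by rewrite big_distrr /=; apply: eq_bigr => i _; rewrite /bump expnS mulnCA.
case: j jp => [|j] jp.
  by rewrite expn0 divn1 addnC mulnC modnMDl modn_small // db.
rewrite expnS divnMA addnC mulnC divnMDl // [d 0 %/ b]divn_small ?addn0 ?db //.
exact: (IH (fun i => d i.+1) j (fun i => db i.+1) jp).
Qed.

Lemma digit_sum_lt b p (d : nat -> nat) : (forall i, i < p -> d i < b) ->
  \sum_(i < p) d i * b ^ i < b ^ p.
Proof.
elim: p => [|p IH] db; first by rewrite big_ord0 expn0.
rewrite big_ord_recr /= expnS.
have := IH (fun i lip => db i (ltnW lip)); have := db p (ltnSn p).
by move: (\sum_(_ < _) _) (b ^ p) => s q; nia.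
Qed.

Lemma runs_assign K M m x e v : den K M m e v -> wf e -> nv + regs e <= K ->
  isname x -> m zr = 0 ->
  runs M (assign x e) m (fun m' => m' zr = 0 /\ agree K m' (upd m x v)).
Proof.
move=> De we Ke /andP[xnv xz] z0; apply: runs_seq.
apply: runs_mono (runs_compile De we (leqnn _) Ke (fun _ _ _ => erefl) z0).
move=> m1 [v1 H1]; apply: runs_basic => //=; split.
  by rewrite /upd ifN ?H1 // eq_sym.
by move=> r rz lr; rewrite /upd; case: eqP => // _; rewrite H1.
Qed.

Section Main.
Variables (K n : nat) (orig : memory).
Local Notation B := n.+1.
Local Notation tb := (K + n + n * n).
Let inS v := orig (3 + v) == 1.
Let adj i j := orig (3 + n + i * n + j) == 1.
Let k := idx inS n.
Hypothesis K_ge : nv + 90 <= K.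
Hypothesis orig_n : orig 0 = n.
Hypothesis orig_bool : forall a, a != 0 -> a != 2 -> orig a <= 1.

(** The factor 2^(2K) allows the divisions that unpack the input, where both the packed number and
    the divisors are at most 2^K; the other factors serve the arithmetic on states and addresses. *)
Let M := (100 + K) * 2 ^ (2 * K) * B ^ (4 * k + 8).
Let digit i := if i is i'.+1 then orig (3 + i') else orig 1.
Let packed := \sum_(i < K - 2) digit i * 2 ^ i.

Let digit_lt i : digit i < 2.
Proof. by case: i => [|i] /=; rewrite ltnS orig_bool. Qed.

Lemma main_boundM j : j <= 4 * k + 8 -> (100 + K) * B ^ j <= M.
Proof.
move=> jk; rewrite /M; apply: leq_mul; last exact: leq_pexp2l.
by rewrite leq_pmulr // expn_gt0.
Qed.

Lemma main_M2K2 : 2 ^ K * 2 ^ K <= M.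
Proof.
have : 0 < B ^ (4 * k + 8) by rewrite expn_gt0.
rewrite /M -expnD addnn -mul2n; move: (2 ^ _) (B ^ _) => p q q0.
by apply: leq_trans (leq_pmulr _ q0); rewrite leq_pmull.
Qed.

Lemma main_M2K : 2 ^ K <= M.
Proof. by apply: leq_trans main_M2K2; rewrite leq_pmulr // expn_gt0. Qed.

Lemma main_packed : packed * 2 ^ K <= M.
Proof.
apply: leq_trans main_M2K2; rewrite leq_mul2r; apply/orP; right.
apply: ltnW; apply: leq_trans (digit_sum_lt (fun i _ => digit_lt i)) _.
by apply: leq_pexp2l => //; exact: leq_subr.
Qed.

Lemma main_sign : packed %% 2 = orig 1.
Proof.
have := @digit_sum 2 (K - 2) digit 0 (fun i _ => digit_lt i).
by rewrite expn0 divn1; apply; lia.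
Qed.

Lemma main_cell a : 3 <= a -> a < K -> packed %/ 2 ^ (a - 2) %% 2 = orig a.
Proof.
move=> a3 aK; rewrite (digit_sum (fun i _ => digit_lt i)); last by lia.
by rewrite (_ : a - 2 = (a - 3).+1) /= ?subnKC //; lia.
Qed.

(** Register [zr] still holds an input bit here, so no loop or compiled expression may run yet;
    [pack] consists of constantly many increments, decrements and forward tests. One decrement
    clears a bit. *)
Lemma runs_pack : runs M (pack K) orig (fun m => [/\ m 1 = packed,
  forall r, 3 <= r -> r < K -> m r = 0 &
  forall r, r != 1 -> (r < 3) || (K <= r) -> m r = orig r]).
Proof.
pose I p (m : memory) := m 1 = \sum_(i < p.+1) digit i * 2 ^ i /\
  forall r, r != 1 -> m r = orig r.
pose J p (m : memory) := [/\ m 1 = packed,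
  forall r, 3 <= r -> r < 3 + p -> m r = 0 &
  forall r, r != 1 -> (r < 3) || (3 + p <= r) -> m r = orig r].
apply: runs_seq.
apply: runs_mono (seqn_runs (I := I) _ _) => [m [m1 mr]|i m _ [m1 mr]|].
- apply: runs_mono (seqn_runs (I := J) (p := K - 3) _ _) => [m' [? H1 H2]|i m' lip [? H1 H2]|].
  + split=> // r; first by move=> r3 rK; apply: H1; lia.
    by move=> r1 rK; apply: H2; lia.
  + apply: runs_basic => //; split=> //=.
      move=> r r3 rK; rewrite /upd; case: eqP => [_|ri]; last by apply: H1; lia.
      have := @orig_bool (3 + i) isT isT; rewrite -H2 //; [|by lia].
      by move: (m' _) => [|[]].
    by move=> r r1 rK; rewrite /upd ifN ?H2 //; lia.
  + split=> //; last by move=> r ? ?; exact: mr.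
    * rewrite m1 /packed; have -> : (K - 3).+1 = K - 2 by lia. by [].
    * by move=> r ? ?; lia.
- have mi : m (3 + i) = orig (3 + i) by rewrite mr.
  have := @orig_bool (3 + i) isT isT; move=> oi.
  rewrite /I big_ord_recr /=.
  apply: runs_ifnz => [m0|m0].
    by split=> //; rewrite m1 -mi m0 mul0n addn0.
  apply: runs_mono (runs_incs _ _ _ _) => m' [-> mr'].
  split; first by rewrite m1 -mi (_ : m (3 + i) = 1) ?mul1n //; lia.
  by move=> r r1; rewrite mr' // mr.
- by split=> //; rewrite big_ord1 expn0 muln1.
Qed.

Lemma agree_input m m' : agree K m' m ->
  input_ok K n packed orig m -> input_ok K n packed orig m'.
Proof.
move=> ag [n0 p c b]; split; rewrite ?ag //.
  by move=> a Ka atb; rewrite ag ?c ?Ka ?orbT //; lia.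
by move=> a Ka; rewrite ag ?b ?Ka ?orbT //; lia.
Qed.

Lemma agree_globals m m' : agree K m' m ->
  globals_ok K n packed orig m -> globals_ok K n packed orig m'.
Proof.
move=> ag [im ? ? ? ?]; split; rewrite ?ag //; exact: agree_input ag im.
Qed.

Let nvK : nv <= K. Proof. by lia. Qed.

Ltac gok := repeat (apply: globals_ok_upd; [exact: nvK|by []|]); assumption.

Let capv := 4 * (B * B) + 1.

Definition ready (m : memory) : Prop :=
  [/\ globals_ok K n packed orig m, m zr = 0, m 24 = 0, m 25 = 0 &
    m 2 = orig 2 /\ m 26 = capv].

(** 90 bounds the temporaries of every expression that [main] assigns. [regs] ignores the value of a
    constant, so it does not grow with the [K] inside these expressions and choosing [K] from it is
    not circular. *)
Let step x e v m :
  den K M m e v -> wf e -> regs e <= 90 -> isname x -> m zr = 0 ->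
  runs M (assign x e) m (fun m' => m' zr = 0 /\ agree K m' (upd m x v)).
Proof. by move=> De we Ke xn z0; apply: runs_assign De we _ xn z0; lia. Qed.

Lemma runs_cap m : ready m -> runs M cap m (fun m' =>
  [/\ globals_ok K n packed orig m', m' zr = 0, m' 25 = 0 &
     m' 24 = minn (orig 2) capv]).
Proof.
move=> [gm mz m24 m25 [m2 m26]].
pose I j (mu : memory) := [/\ globals_ok K n packed orig mu, mu zr = 0, mu 25 = 0 &
  [/\ mu 26 = j, j <= capv, mu 24 = minn (orig 2) (capv - j) &
     mu 2 = orig 2 - (capv - j)]].
have Ic : I capv m by split=> //; split=> //; rewrite ?subnn ?minn0 ?subn0.
apply: runs_mono (runs_while (I := I) _ _ _ Ic); first last.
- have := main_boundM (j := 2); rewrite -mulnn /capv => H.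
  by apply: leq_trans (H _); [nia|lia].
- move=> j mu jc [gmu muz mu25 [mu26 _ mu24 mu2]]; split; first by rewrite mu26.
  apply: runs_seq; apply: runs_ifnz => m0.
    apply: runs_basic => //=; split=> //; split=> //; first by gok.
    split; rewrite /upd /= ?mu26 //; [exact: ltnW|rewrite mu24; lia|rewrite m0; lia].
  apply: runs_seq; apply: runs_basic => //=; apply: runs_basic => //=.
  apply: runs_basic => //=; split=> //; split=> //.
  + by gok.
  + split; rewrite /upd /= ?mu26 //; [exact: ltnW|rewrite mu24; lia|rewrite mu2; lia].
- by move=> mu [_ _ _ []].
- by move=> mu [gmu muz mu25 [_ _ mu24 _]]; rewrite subn0 in mu24; split.
Qed.

Local Notation Big := (B ^ (2 * k + 2)).
Local Notation cellk := (cell_ok n k inS adj).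

Definition filled (N : nat) (m : memory) : Prop :=
  [/\ globals_ok K n packed orig m, m zr = 0, m 24 = minn (orig 2) capv &
    forall b, b < N -> m (tb + b) = cellk b].

Lemma runs_fill m : globals_ok K n packed orig m -> m zr = 0 ->
  m 24 = minn (orig 2) capv -> m 25 = 0 -> m 26 = B * Big ->
  runs M (fill K) m (filled (B * Big)).
Proof.
move=> gm mz m24 m25 m26; pose N := B * Big.
have NE : N = B ^ (2 * k + 3) by rewrite /N -expnS -addnS.
have NM : N <= M.
  by apply: leq_trans (main_boundM (j := 2 * k + 3) _); [rewrite NE; lia|lia].
pose I j (mu : memory) := filled (N - j) mu /\
  [/\ mu 25 = N - j, mu 26 = j & j <= N].
have IN : I N m.
  by split; rewrite ?subnn //; split.
apply: runs_mono (runs_while (I := I) _ _ NM IN).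
- by move=> mu [? _]; rewrite -/N -[N]subn0.
- by move=> mu [_ []].
move=> j m0 jN [[g0 z0 m024 tab] [m025 m026 _]]; split; first by rewrite m026.
have [i0 k0 Bk0 Big0 tb0] := g0.
set a := N - j.+1 in tab m025.
have aN : a < N by rewrite /a; lia.
apply: runs_seq.
have Dstep : den K M m0 (eStep K) (cellk a).
  apply: (@den_step _ _ _ packed orig); rewrite -?NE //.
  - exact: main_boundM.
  - exact: main_M2K.
  - exact: main_packed.
  - by move=> r r3; apply: orig_bool; lia.
  - exact: main_sign.
  - exact: main_cell.
apply: runs_mono (step (x := 27) Dstep _ _ _ z0) => // m1 [z1 ag1].
have g1 : globals_ok K n packed orig m1 by apply: agree_globals ag1 _; gok.
have m1E r : r != 27 -> r != zr -> (r < nv) || (K <= r) -> m1 r = m0 r.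
  by move=> r27 rz lr; rewrite ag1 // /upd ifN.
have m127 : m1 27 = cellk a by rewrite ag1.
apply: runs_seq.
have Dadd : den K M m1 (eAdd (Var 12) (Var 25)) (tb + a).
  apply: den_add; [|by apply: den_name; rewrite m1E|lia].
  by apply: den_name; rewrite m1E.
apply: runs_mono (step (x := 28) Dadd _ _ _ z1) => // m2 [z2 ag2].
have g2 : globals_ok K n packed orig m2 by apply: agree_globals ag2 _; gok.
have m2E r : r != 27 -> r != 28 -> r != zr -> (r < nv) || (K <= r) -> m2 r = m0 r.
  by move=> r27 r28 rz lr; rewrite ag2 // /upd ifN // m1E.
have m227 : m2 27 = cellk a by rewrite ag2.
have m228 : m2 28 = tb + a by rewrite ag2.
(* The stored cell lies beyond the names, the temporaries and the input, and its value is a bit, so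
   [globals_ok] survives the store. *)
apply: runs_seq; apply: runs_basic => //=; rewrite m228 m227.
apply: runs_seq; apply: runs_basic => //=; apply: runs_basic => //=.
set m3 := upd m2 (tb + a) (cellk a).
have m3E r : r < nv -> m3 r = m2 r by move=> rn; rewrite /m3 /upd ifN //; lia.
have g3 : globals_ok K n packed orig m3.
  have [[n2 p2 c2 b2] k2 Bk2 Big2 tb2] := g2.
  split; rewrite ?m3E //; split; rewrite ?m3E //.
    by move=> b Kb btb; rewrite -c2 // /m3 /upd ifN //; lia.
  move=> b Kb; rewrite /m3 /upd; case: eqP => _; first exact: leq_b1.
  exact: b2.
split; first by rewrite /upd /= m3E.
split; first split.
- by gok.
- by rewrite /upd /= m3E.
- by rewrite /upd /= m3E // m2E.
- move=> b bj; rewrite /upd !ifN; [|by lia|by lia].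
  rewrite /m3 /upd; case: eqP => [ab|ab]; first by have -> : b = a by lia.
  by rewrite m2E ?tab //; lia.
split; [| |by lia].
- by rewrite /upd /= !m3E // m2E // m025 /a; lia.
- by rewrite /upd /= !m3E // m2E // m026.
Qed.

Lemma runs_main : runs M (main K) orig (fun m => m 0 =
  ((orig 1 == 0) && [exists s : 'I_Big,
     cellk (n * Big + s) && (fin n k inS adj s <= orig 2)])).
Proof.
apply: runs_seq; apply: runs_mono runs_pack => m0 [m01 m0z m0E].
have oi a : 3 <= a -> orig a <= 1 by move=> a3; apply: orig_bool; lia.
have i0 : input_ok K n packed orig m0.
  split=> //; first by rewrite m0E.
    by move=> a Ka _; rewrite m0E ?Ka ?orbT //; lia.
  by move=> a Ka; rewrite m0E ?Ka ?orbT ?oi //; lia.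
have z0 : m0 zr = 0 by apply: m0z => //; lia.
have iok m m' x v : input_ok K n packed orig m ->
    (x < nv) && (x \notin [:: 0; 1]) -> agree K m' (upd m x v) ->
    input_ok K n packed orig m'.
  move=> im xn ag; apply: agree_input ag _; exact: input_ok_upd.
have kn : k <= n by exact: k_le_n.
have BM j : j <= 4 * k + 8 -> (100 + K) * B ^ j <= M by exact: main_boundM.
have BBM : (100 + K) * (B * B) <= M by have := BM 2; rewrite -mulnn; apply; lia.
have nM : n <= M by nia.
have M0 : 0 < M by nia.
have dB m : input_ok K n packed orig m -> den K M m eB B.
  by move=> im; apply: den_succ; apply: den_name; exact: iok_n im.
apply: runs_seq.
have d9 : den K M m0 (eIdx K (Var 0)) k.
  apply: (@den_idx _ _ n packed orig) => //; try exact: main_cell.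
  - exact: main_M2K.
  - exact: main_packed.
  - exact: main_sign.
  - by apply: den_name; exact: iok_n i0.
apply: runs_mono (step (x := 9) d9 _ _ _ z0) => // m1 [z1 ag1].
have i1 := iok _ _ 9 _ i0 isT ag1.
have m19 : m1 9 = k by rewrite ag1.
apply: runs_seq.
have d10 : den K M m1 (ePow eB (Var 9)) (B ^ k).
  apply: (den_pow M0) => //; [exact: dB|exact: den_name|by lia|].
  by have := BM k; lia.
apply: runs_mono (step (x := 10) d10 _ _ _ z1) => // m2 [z2 ag2].
have i2 := iok _ _ 10 _ i1 isT ag2.
have m29 : m2 9 = k by rewrite ag2.
have m210 : m2 10 = B ^ k by rewrite ag2.
apply: runs_seq.
have d11 : den K M m2 eBig Big.
  apply: (den_pow M0) => //; [exact: dB| |by nia|].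
    apply: den_add; [|exact: den_cst|by nia].
    by rewrite mul2n -addnn; apply: den_add; [exact: den_name|exact: den_name|lia].
  by have := BM (2 * k + 2); lia.
apply: runs_mono (step (x := 11) d11 _ _ _ z2) => // m3 [z3 ag3].
have i3 := iok _ _ 11 _ i2 isT ag3.
have m39 : m3 9 = k by rewrite ag3.
have m310 : m3 10 = B ^ k by rewrite ag3.
have m311 : m3 11 = Big by rewrite ag3.
apply: runs_seq.
have d12 : den K M m3 (eTb K) tb.
  have dn : den K M m3 (Var 0) n by apply: den_name; exact: iok_n i3.
  apply: den_add; [|exact: den_mul|by nia].
  by apply: den_add; [exact: den_cst|exact: dn|].
apply: runs_mono (step (x := 12) d12 _ _ _ z3) => // m4 [z4 ag4].
have i4 := iok _ _ 12 _ i3 isT ag4.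
have g4 : globals_ok K n packed orig m4 by split=> //; rewrite ag4.
have low4 r : r \in [:: 2; 24; 25] -> m4 r = m0 r.
  by rewrite !inE => /or3P[]/eqP->; rewrite ag4 // /upd /= ag3 // /upd /= ag2 // /upd /= ag1.
apply: runs_seq.
have d26 : den K M m4 eCap capv.
  apply: den_add; [|exact: den_cst|by nia].
  apply: den_mul; [exact: den_cst| |by nia|by nia].
  by apply: den_mul; [exact: dB|exact: dB|nia|nia].
apply: runs_mono (step (x := 26) d26 _ _ _ z4) => // m5 [z5 ag5].
have g5 : globals_ok K n packed orig m5 by apply: agree_globals ag5 _; gok.
apply: runs_seq; apply: runs_mono (runs_cap (m := m5) _); last first.
  split=> //; rewrite ?ag5 //.
  - by rewrite /upd /= low4 // m0z //; lia.
  - by rewrite /upd /= low4 // m0z //; lia.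
  - by rewrite /upd /= low4 // m0E.
move=> m6 [g6 z6 m625 m624].
apply: runs_seq.
have [i6 m69 m610 m611 m612] := g6.
have BBig : B * Big = B ^ (2 * k + 3) by rewrite -expnS -addnS.
have BigM : (100 + K) * Big <= M by apply: BM; lia.
have dN : den K M m6 (eMul eB (Var 11)) (B * Big).
  by apply: den_mul; [exact: dB|exact: den_name|nia|lia].
apply: runs_mono (step (x := 26) dN _ _ _ z6) => // m7 [z7 ag7].
have g7 : globals_ok K n packed orig m7 by apply: agree_globals ag7 _; gok.
apply: runs_seq; apply: runs_mono (runs_fill (m := m7) g7 z7 _ _ _).
- move=> m8 [g8 z8 m824 tab].
  (* Truncation is harmless: [fin] never exceeds [capv], so comparing it with |t| or with the
     minimum gives the same answer. *)
  have capE s : s < Big -> (fin n k inS adj s <= orig 2) =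
      (fin n k inS adj s <= minn (orig 2) capv).
    move=> sB; have := @fin_le n k inS adj erefl s sB.
    by rewrite leq_min -mulnn /capv; lia.
  have -> : [exists s : 'I_Big, cellk (n * Big + s) && (fin n k inS adj s <= orig 2)]
     = [exists s : 'I_Big, cellk (n * Big + s) &&
          (fin n k inS adj s <= minn (orig 2) capv)].
    by apply: eq_existsb => s; rewrite capE.
  have d0 : den K M m8 (eResult K) ((orig 1 == 0) && [exists s : 'I_Big,
      cellk (n * Big + s) && (fin n k inS adj s <= minn (orig 2) capv)]).
    apply: (@den_result _ _ n packed orig) => //;
      try first [exact: main_M2K | exact: main_packed | exact: main_sign | exact: main_cell].
    + by rewrite geq_min; apply/orP; right; rewrite /capv; nia.
    + by rewrite -BBig.
  apply: runs_mono (step (x := 0) d0 _ _ _ z8) => //.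
  by move=> m9 [_ ag9]; rewrite ag9.
- by rewrite ag7.
- by rewrite ag7.
- by rewrite ag7.
Qed.

End Main.

(** * Digits of states, and what the table contains *)

Section Digits.
Variables (n k : nat) (inS : nat -> bool) (adj : nat -> nat -> bool).
Local Notation B := n.+1.
Local Notation theta := (theta n inS).
Local Notation idx := (idx inS).
Local Notation wt := (wt n k inS adj).
Local Notation valid := (valid n inS adj).

Lemma dig_addM i j a q : i < j -> dig n i (a + q * B ^ j) = dig n i a.
Proof.
move=> ij; have -> : q * B ^ j = q * B ^ (j - i.+1) * B * B ^ i.
  by rewrite -!mulnA -expnS -expnD; congr (_ * _ ^ _); lia.
by rewrite /dig addnC divnMDl ?expn_gt0 // modnMDl.
Qed.

Lemma idx_lt u v : inS u -> u < v -> idx u < idx v.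
Proof.
move=> uS uv; rewrite /idx -(subnKC uv) big_split_ord big_ord_recr /= uS.
by rewrite addn1 addSn ltnS leq_addr.
Qed.

(** A right inverse of [theta]: it packs values indexed by S into a number. The bound [m] is a
    parameter for the sake of induction. *)
Definition digits_of (m : nat) (F : nat -> nat) : nat :=
  \sum_(v < m) inS v * (F v * B ^ idx v).

Lemma digits_of_lt m F : (forall v, v < m -> inS v -> F v <= n) -> digits_of m F < B ^ idx m.
Proof.
elim: m => [|m IH] Fn; first by rewrite /digits_of /idx !big_ord0 expn0.
rewrite /digits_of big_ord_recr /= -/(digits_of m F).
have -> : idx m.+1 = inS m + idx m by rewrite /idx big_ord_recr /= addnC.
have {}IH := IH (fun v vm => Fn v (ltnW vm)).
case mS: (inS m); rewrite /= ?mul0n ?addn0 // mul1n add1n expnS.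
by move: (B ^ _) IH (Fn m (ltnSn m) mS) => q; nia.
Qed.

Lemma theta_digits_of m F v : (forall v, v < m -> inS v -> F v <= n) -> v < m -> inS v ->
  theta v (digits_of m F) = F v.
Proof.
elim: m => [//|m IH] Fn vm vS.
have Fm u : u < m -> inS u -> F u <= n by move=> um; apply: Fn; exact: ltnW.
rewrite /digits_of big_ord_recr /= -/(digits_of m F).
move: vm vS; rewrite ltnS leq_eqVlt => /orP[/eqP -> |vm] vS.
  rewrite vS mul1n /theta /dig addnC divnMDl ?expn_gt0 // divn_small ?digits_of_lt //.
  by rewrite addn0 modn_small // ltnS ?Fn //.
case: (inS m); last by rewrite mul0n addn0 IH.
by rewrite mul1n /theta dig_addM ?idx_lt // -/(theta v (digits_of m F)) IH.
Qed.

Lemma eq_valid a a' x c : (forall v, v < n -> inS v -> theta v a = theta v a') ->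
  valid a x c = valid a' x c.
Proof.
move=> aa; apply: eq_forallb => v; case vS: (inS v) => //=; congr (_ && _).
by apply: eq_forallb => w; case wS: (inS w) => //=; rewrite !aa.
Qed.

(** Adding a clique thus never touches the low k digits, which hold the order of S. *)
Lemma wt_dvd x c : exists q, wt x c = q * B ^ k.
Proof.
exists (rep inS adj x * (\sum_(v < n) (inS v && adj x v) * (theta v c * B ^ idx v)
   + clcost n inS adj x c * B ^ k)).
rewrite /wt /wt_sum -mulnA; congr (_ * _); rewrite mulnDl mul2n -addnn expnD mulnA.
congr (_ + _); rewrite big_distrl; apply: eq_bigr => v _.
by rewrite expnD !mulnA mulnAC.
Qed.

Lemma sum_wt_dvd x (C : nat -> nat) : exists q, \sum_(y < x) wt y (C y) = q * B ^ k.
Proof.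
elim: x => [|x [q IH]]; first by exists 0; rewrite big_ord0.
have [q' E] := wt_dvd x (C x); exists (q + q').
by rewrite big_ord_recr /= IH E mulnDl.
Qed.

Hypothesis k_def : k = idx n.

Lemma theta_low p q v : v < n -> inS v -> theta v (p + q * B ^ k) = theta v p.
Proof. by move=> vn vS; rewrite /theta dig_addM // k_def idx_lt. Qed.

(** The recursion unrolls to one initial vector [p] and one choice per vertex. Validity along the
    way can be stated for [p] because every intermediate state has the low digits of [p]. *)
Lemma reachP x s : reach n k inS adj x s <->
  exists p (C : nat -> nat), [/\ p < B ^ k, forall y, y < x -> C y < B ^ k /\ valid p y (C y) &
    s = p + \sum_(y < x) wt y (C y)].
Proof.
elim: x s => [|x IH] s /=.
  split=> [sB|[p [C [pB _ ->]]]]; last by rewrite big_ord0 addn0.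
  by exists s, (fun=> 0); split=> //; rewrite big_ord0 addn0.
split.
- case/existsP=> c /and3P[va ws /IH[p [C [pB HC E]]]].
  exists p, (fun y => if y == x then val c else C y).
  have eqC : \sum_(y < x) wt y (if y == x :> nat then val c else C y)
      = \sum_(y < x) wt y (C y).
    by apply: eq_bigr => y _; rewrite ltn_eqF.
  have sE : s = p + \sum_(y < x.+1) wt y (if y == x :> nat then val c else C y).
    by rewrite big_ord_recr /= eqC eqxx addnA -E subnK.
  split=> // y; rewrite ltnS leq_eqVlt => /orP[/eqP ->|yx].
    rewrite eqxx; split; first exact: ltn_ord.
    rewrite -(@eq_valid s) // => v vn vS.
    have [q Eq] := sum_wt_dvd x.+1 (fun y => if y == x then val c else C y).
    by rewrite sE Eq theta_low.
  by rewrite ltn_eqF //; exact: HC.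
- case=> p [C [pB HC ->]]; have [cB va] := HC x (ltnSn x).
  apply/existsP; exists (Ordinal cB) => /=.
  have [q Eq] := sum_wt_dvd x.+1 C.
  rewrite (@eq_valid _ p) => [|v vn vS]; last by rewrite Eq theta_low.
  rewrite va big_ord_recr /= addnA leq_addl addnK; apply/IH.
  by exists p, C; split=> // y yx; apply: HC; exact: ltnW.
Qed.

End Digits.

(** An injective key gives the elements of [A] the ranks 0, ..., #|A| - 1. Removing the element of
    largest key keeps the other ranks, and its own rank is #|A| - 1. *)
Lemma sum_rank (T : finType) (A : {set T}) (f : T -> nat) (F : nat -> nat) :
  {in A &, injective f} ->
  \sum_(z in A) F #|[set w in A | f w < f z]| = \sum_(j < #|A|) F j.
Proof.
move: {2}#|A| (erefl #|A|) => m; elim: m A => [|m IH] A cA injf.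
  by move/eqP: (cA); rewrite cards_eq0 => /eqP ->; rewrite cards0 big_ord0 big_set0.
have /card_gt0P[x xA] : 0 < #|A| by rewrite cA.
case: (arg_maxnP f xA) => z0 z0A fmax0; have {}z0A : z0 \in A by [].
have fmax w : w \in A -> f w <= f z0 by exact: fmax0.
have cA' : #|A :\ z0| = m by move: cA; rewrite (cardsD1 z0) z0A => -[].
rewrite (big_setD1 z0) //= cA big_ord_recr /= addnC -cA'; congr (_ + _).
  rewrite -IH //; last by move=> u v /setD1P[_ uA] /setD1P[_ vA]; exact: injf.
  apply: eq_bigr => z /setD1P[zz0 zA]; congr F; apply: eq_card => w.
  rewrite !inE; case: eqP => // -> /=; rewrite z0A /=; apply/negbTE.
  by rewrite -leqNgt fmax.
congr F; apply: eq_card => w; rewrite !inE.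
case: eqP => [->|wz0] /=; first by rewrite ltnn andbF.
case wA: (w \in A) => //=; rewrite ltn_neqAle fmax // andbT.
by apply/eqP => /injf E; apply: wz0; exact: E.
Qed.

Lemma perm_of_key n (key : 'I_n -> nat) : injective key ->
  exists s : {perm 'I_n}, forall u v, (s u < s v) = (key u < key v).
Proof.
move=> injk; pose rk (u : 'I_n) := #|[set w | key w < key u]|.
have rk_lt u v : key u < key v -> rk u < rk v.
  move=> uv; apply: proper_card; apply/properP; split.
    by apply/subsetP => w; rewrite !inE => /ltn_trans; apply.
  by exists u; rewrite !inE ?ltnn.
have rkn u : rk u < n.
  rewrite -[n in _ < n]card_ord -cardsT; apply: proper_card; apply/properP.
  by split; [exact: subsetT|exists u; rewrite !inE ?ltnn].
have rkE u v : (rk u < rk v) = (key u < key v).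
  case: (ltngtP (key u) (key v)) => [/rk_lt //|/rk_lt|/injk -> ]; last by rewrite ltnn.
  by move=> vu; apply/negbTE; rewrite -leqNgt ltnW.
have injr : injective (fun u => Ordinal (rkn u)).
  move=> u v [] E; apply: injk; have := rkE u v; have := rkE v u.
  by rewrite E ltnn; lia.
by exists (perm injr) => u v; rewrite !permE /= rkE.
Qed.

(** * Layouts and states *)

Lemma sum_card (T : finType) (P : pred T) : \sum_(i : T) P i = #|[set i | P i]|.
Proof. by rewrite -sum1_card [RHS]big_mkcond; apply: eq_bigr => i _; rewrite inE; case: (P i). Qed.

Section Graph.
Variables (n : nat) (e : rel 'I_n) (S : {set 'I_n}).
Variables (inS : nat -> bool) (adj : nat -> nat -> bool).
Local Notation B := n.+1.
Hypothesis e_sym : symmetric e.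
Hypothesis e_irr : irreflexive e.
Hypothesis tc : twin_cover e S.
Hypothesis inSE : forall v : 'I_n, inS v = (v \in S).
Hypothesis adjE : forall u v : 'I_n, adj u v = e u v.
Let k := idx inS n.
Local Notation theta := (theta n inS).
Local Notation rep := (rep inS adj).

(** For [y] outside S this is the component of [y] in G - S: its vertices are true twins of [y],
    hence neighbours of [y]. *)
Definition clq (y : 'I_n) : {set 'I_n} := closed_nbhd e y :\: S.

Lemma in_clq y z : (z \in clq y) = (z \notin S) && ((z == y) || e y z).
Proof. by rewrite !inE. Qed.

Lemma clq_nbhd y z : y \notin S -> z \in clq y -> closed_nbhd e z = closed_nbhd e y.
Proof.
move=> yS; rewrite in_clq => /andP[zS /orP[/eqP -> //|eyz]].
by apply/esym/tc => //; apply: connect1; rewrite /rel_minus eyz yS.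
Qed.

Lemma clq_eq y z : y \notin S -> z \in clq y -> clq z = clq y.
Proof. by move=> yS zy; rewrite /clq (clq_nbhd yS zy). Qed.

Lemma clq_adj y z v : y \notin S -> z \in clq y -> v \in S -> e z v = e y v.
Proof.
move=> yS zy vS; have /setP/(_ v) := clq_nbhd yS zy; rewrite !inE.
have zS : z \notin S by move: zy; rewrite in_clq => /andP[].
have vz : v != z by apply: contraNneq zS => <-.
have vy : v != y by apply: contraNneq yS => <-.
by rewrite (negbTE vz) (negbTE vy).
Qed.

Lemma clq_sym y z : y \notin S -> z \in clq y -> y \in clq z.
Proof. by move=> yS zy; rewrite (clq_eq yS zy) in_clq yS eqxx. Qed.

Lemma cszE (y : 'I_n) : csz n inS adj y = #|clq y|.
Proof.
rewrite -sum1_card [RHS]big_mkcond; apply: eq_bigr => z _ /=.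
by rewrite in_clq inSE adjE val_eqE; case: (_ && _).
Qed.

Lemma repE (x : 'I_n) :
  rep x = (x \notin S) && [forall y, (y \in clq x) ==> (x <= y)].
Proof.
rewrite /rep inSE; congr (_ && _); apply/idP/forallP => [H y|H].
  apply/implyP; rewrite in_clq => /andP[yS /orP[/eqP -> //|exy]].
  rewrite leqNgt; apply/negP => yx; move/negP: H; apply.
  by apply/existsP; exists (Ordinal yx); rewrite /= inSE yS adjE.
apply/negP => /existsP[[y yx] /= /andP[yS axy]].
have yn : y < n by exact: ltn_trans yx (ltn_ord x).
have := H (Ordinal yn); rewrite in_clq -inSE yS /= -adjE axy orbT /=.
by rewrite leqNgt yx.
Qed.

Definition root (z : 'I_n) : 'I_n := [arg min_(y < z | y \in clq z) val y].

Lemma root_rep z : z \notin S -> rep (root z).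
Proof.
move=> zS; rewrite /root; case: arg_minnP => [|y yz ymin].
  by rewrite in_clq zS eqxx.
have yS : y \notin S by move: yz; rewrite in_clq => /andP[].
rewrite repE yS; apply/forallP => w; apply/implyP => wy.
by apply: ymin; rewrite -(clq_eq zS yz).
Qed.

Lemma rootE (y z : 'I_n) : rep y -> (z \notin S) && (root z == y) = (z \in clq y).
Proof.
rewrite repE => /andP[yS /forallP ymin]; apply/andP/idP => [[zS /eqP <-]|zy].
  rewrite /root; case: arg_minnP => [|w wz _]; first by rewrite in_clq zS eqxx.
  exact: clq_sym.
have zS : z \notin S by move: zy; rewrite in_clq => /andP[].
split=> //; rewrite /root; case: arg_minnP => [|w wz wmin].
  by rewrite in_clq zS eqxx.
apply/eqP/val_inj/eqP; rewrite /= eqn_leq wmin /=; last exact: clq_sym.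
by apply: (implyP (ymin w)); rewrite -(clq_eq yS zy).
Qed.

Lemma sum_clq (F : 'I_n -> nat) :
  \sum_(z | z \notin S) F z = \sum_(y : 'I_n | rep y) \sum_(z in clq y) F z.
Proof.
rewrite (partition_big root (fun y : 'I_n => rep y)) /=; last exact: root_rep.
by apply: eq_bigr => y ry; apply: eq_bigl => z; rewrite rootE.
Qed.

(** The left neighbours of [v] are split: those in S follow from the positions, those in cliques
    ([LC]) are what the upper k digits of a state accumulate. *)
Definition LS (p v : nat) : nat := \sum_(u < n) (inS u && adj v u && precedes n inS p u v).
Definition LC (C : nat -> nat) (v : nat) : nat :=
  \sum_(y < n) (rep y && adj y v) * theta v (C y).
Definition total (p : nat) (C : nat -> nat) : nat :=
  \sum_(y < n) rep y * clcost n inS adj y (C y) +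
  \sum_(v < n) inS v * absdiff (LC C v + LS p v)
                               (\sum_(u < n) adj v u - (LC C v + LS p v)).

(** * Layouts that realise given positions and counts *)

Section Match.
Variables (s : {perm 'I_n}) (p : nat) (C : nat -> nat).
Hypothesis precedesE : forall u v : 'I_n, u \in S -> v \in S ->
  precedes n inS p u v = (s u < s v).
Hypothesis thetaE : forall y v : 'I_n, rep y -> v \in S -> e y v ->
  theta v (C y) = #|[set z in clq y | s z < s v]|.

Lemma card_NL_S v : v \in S -> #|NL e s v| = LC C v + LS p v.
Proof.
move=> vS; rewrite /NL -sum_card (bigID (fun u => u \in S)) /= addnC; congr (_ + _).
  rewrite sum_clq /LC [in RHS](bigID (fun y : 'I_n => rep y)) /=.
  rewrite [X in _ = _ + X]big1 ?addn0 => [|y /negbTE -> //].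
  apply: eq_bigr => y ry; rewrite ry adjE /=.
  have yS : y \notin S by move: ry; rewrite repE => /andP[].
  case eyv : (e y v); last first.
    rewrite mul0n big1 // => z zy; rewrite e_sym (clq_adj yS zy vS) eyv //.
  rewrite mul1n thetaE // -sum1dep_card big_mkcondr /=.
  apply: eq_bigr => z zy; rewrite e_sym (clq_adj yS zy vS) eyv /=.
  by case: ltnP.
rewrite big_mkcond /=; apply: eq_bigr => u _; rewrite inSE adjE.
by case uS: (u \in S) => //=; rewrite precedesE.
Qed.

Lemma card_NR_S v : v \in S ->
  #|NR e s v| = \sum_(u < n) adj v u - (LC C v + LS p v).
Proof.
move=> vS; rewrite -card_NL_S // /NL /NR -!sum_card.
rewrite (_ : \sum_(u < n) adj v u = \sum_u (e v u && (s u < s v)) +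
   \sum_u (e v u && (s v < s u))) ?addKn //.
rewrite -big_split /=; apply: eq_bigr => u _; rewrite adjE.
case evu: (e v u) => //=; case: (ltngtP (s u) (s v)) => // /val_inj/perm_inj uv.
by move: evu; rewrite uv e_irr.
Qed.

(** The clique vertices before [v] and those before [z] are nested initial segments of the clique,
    and [z] belongs to the first exactly when it precedes [v]. *)
Lemma clq_before (y v z : 'I_n) : rep y -> v \in S -> e y v -> z \in clq y ->
  (s v < s z) = (theta v (C y) <= #|[set w in clq y | s w < s z]|).
Proof.
move=> ry vS eyv zy; rewrite thetaE //.
have zS : z \notin S by move: zy; rewrite in_clq => /andP[].
case: (ltngtP (s v) (s z)) => [vz|zv|/val_inj/perm_inj vz].
- apply/esym/subset_leq_card/subsetP => w; rewrite !inE => /andP[-> /=].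
  by move=> wv; exact: ltn_trans wv vz.
- apply/esym/negbTE; rewrite -ltnNge; apply: proper_card; apply/properP; split.
    apply/subsetP => w; rewrite !inE => /andP[-> /=].
    by move=> wz; exact: ltn_trans wz zv.
  by exists z; rewrite inE ?zy ?ltnn.
- by move: zS; rewrite -vz vS.
Qed.

Lemma vertex_clq (y z : 'I_n) : rep y -> z \in clq y ->
  vertex_imbalance e s z =
  absdiff (lft n inS adj y (C y) #|[set w in clq y | s w < s z]|)
          (rgt n inS adj y (C y) #|[set w in clq y | s w < s z]|).
Proof.
move=> ry zy; set j := #|_|.
have yS : y \notin S by move: ry; rewrite repE => /andP[].
have zS : z \notin S by move: zy; rewrite in_clq => /andP[].
have clqz u : u \notin S -> (u == z) || e z u = (u \in clq y).
  by move=> uS; rewrite -(clq_eq yS zy) in_clq uS.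
rewrite /vertex_imbalance /NL /NR -!sum_card /lft /rgt; congr absdiff.
- rewrite (bigID (fun u => u \in S)) /= addnC; congr (_ + _).
    rewrite /j -sum_card [RHS](bigID (fun u => u \in S)) /=.
    rewrite [X in X + _]big1 ?add0n => [|u uS]; last by rewrite in_clq uS.
    apply: eq_bigr => u uS; rewrite -clqz //.
    by case: eqP => [->|_] //=; rewrite ltnn andbF.
  rewrite big_mkcond; apply: eq_bigr => v _; rewrite inSE adjE.
  case vS: (v \in S) => //=; rewrite (clq_adj yS zy vS).
  by case eyv : (e y v) => //=; rewrite -clq_before.
- rewrite (bigID (fun u => u \in S)) /= addnC; congr (_ + _).
    have -> : \sum_(u | u \notin S) (e z u && (s z < s u)) =
        #|[set w in clq y | s z < s w]|.
      rewrite -sum_card [RHS](bigID (fun u => u \in S)) /=.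
      rewrite [X in X + _]big1 ?add0n => [|u uS]; last by rewrite in_clq uS.
      apply: eq_bigr => u uS; rewrite -clqz //.
      by case: eqP => [->|_] //=; rewrite ltnn andbF.
    rewrite cszE (cardsD1 z (clq y)) zy; have -> : #|clq y :\ z| = j + #|[set w in clq y | s z < s w]|.
      rewrite -[LHS]sum1_card big_mkcond /= /j -!sum_card -big_split /=.
      apply: eq_bigr => w _; rewrite in_setD1 andbC.
      case: (eqVneq w z) => [->|wz]; first by rewrite ltnn !andbF.
      case: (ltngtP (s w) (s z)) => [| |/val_inj/perm_inj E]; rewrite ?andbT ?andbF.
      - by case: (w \in _).
      - by case: (w \in _).
      - by rewrite E eqxx in wz.
    by lia.
  rewrite big_mkcond; apply: eq_bigr => v _; rewrite inSE adjE.
  case vS: (v \in S) => //=; rewrite (clq_adj yS zy vS).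
  case eyv : (e y v) => //=; rewrite [in RHS]ltnNge /j -clq_before //.
  have vz : v <> z by move=> vz; move: zS; rewrite -vz vS.
  by case: (ltngtP (s v) (s z)) => // /val_inj/perm_inj.
Qed.

(** The imbalance of a clique vertex depends only on its rank in the clique, so which twin has which
    rank is irrelevant and [sum_rank] turns the sum over the clique into [clcost]. *)
Lemma layout_total : layout_imbalance e s = total p C.
Proof.
rewrite /layout_imbalance (bigID (fun v => v \in S)) /= addnC; congr (_ + _).
  rewrite sum_clq [RHS](bigID (fun y : 'I_n => rep y)) /=.
  rewrite [X in _ = _ + X]big1 ?addn0 => [|y /negbTE -> //].
  apply: eq_bigr => y ry; rewrite ry mul1n /clcost cszE.
  rewrite -(sum_rank (f := fun z => s z) (fun j => absdiff (lft n inS adj y (C y) j)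
      (rgt n inS adj y (C y) j))) => [|u v _ _ /val_inj/perm_inj //].
  by apply: eq_bigr => z zy; exact: vertex_clq.
rewrite big_mkcond; apply: eq_bigr => v _; rewrite inSE.
case vS: (v \in S) => //; rewrite mul1n /vertex_imbalance.
by rewrite card_NR_S // card_NL_S.
Qed.

End Match.

(** * Translation between layouts and encoded data *)

Local Notation valid := (valid n inS adj).
Local Notation csz := (csz n inS adj).
Local Notation clcost := (clcost n inS adj).
Local Notation digits_of := (digits_of n inS).

Definition encoded (p : nat) (C : nat -> nat) : Prop :=
  p < B ^ k /\ forall y, y < n -> C y < B ^ k /\ valid p y (C y).

Lemma sum_csz_le : \sum_(y < n) rep y * csz y <= n.
Proof.
rewrite (bigID (fun y : 'I_n => rep y)) /=.
rewrite [X in _ + X]big1 ?addn0 => [|y /negbTE -> //].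
apply: (@leq_trans (\sum_(y : 'I_n | rep y) \sum_(z in clq y) 1)).
  by apply: leq_sum => y ry; rewrite ry mul1n cszE sum1_card.
by rewrite -(sum_clq (fun=> 1)) sum1_card -[leqRHS]card_ord max_card.
Qed.

(** Left and right neighbours of a clique vertex together number less than n. Unlike [clcost_le],
    this adds up over disjoint cliques to at most n * n, so the total cost fits in two digits. *)
Lemma clcost_csz_le y c : clcost y c <= csz y * n.
Proof.
rewrite -[csz y in leqRHS]card_ord -sum_nat_const; apply: leq_sum => j _.
have jc := ltn_ord j.
pose P v := inS v && adj y v.
have : csz y + \sum_(v < n) P v <= n.
  rewrite -big_split /= -[leqRHS]card_ord -sum1_card; apply: leq_sum => v _.
  by rewrite /P; case: (inS v); case: (_ == _); case: (adj y v).
have <- : \sum_(v < n) (P v && (theta v c <= j)) +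
    \sum_(v < n) (P v && (j < theta v c)) = \sum_(v < n) P v.
  rewrite -big_split /=; apply: eq_bigr => v _.
  by case: (P v) => //=; case: leqP.
by rewrite /absdiff /lft /rgt /P; lia.
Qed.

Lemma theta_csz p C (y v : 'I_n) : encoded p C -> v \in S -> theta v (C y) <= csz y.
Proof.
case=> _ /(_ y (ltn_ord y))[_ /forallP/(_ v)].
by rewrite inSE => /implyP H /H /andP[].
Qed.

Lemma theta_mono p C (y v w : 'I_n) : encoded p C -> v \in S -> w \in S ->
  theta v p <= theta w p -> theta v (C y) <= theta w (C y).
Proof.
case=> _ /(_ y (ltn_ord y))[_ /forallP/(_ v)].
rewrite inSE => /implyP H /H /andP[_ /forallP/(_ w)].
by rewrite inSE => /implyP H' wS vw; apply: H'; rewrite wS.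
Qed.

(** Each count is at most the size of its clique and the cliques are disjoint, so the accumulated
    counts stay single digits in base n + 1. *)
Lemma LC_le p C v : encoded p C -> v < n -> inS v -> LC C v <= n.
Proof.
move=> enc vn vS; apply: leq_trans sum_csz_le; apply: leq_sum => y _.
have := theta_csz (v := Ordinal vn) y enc; rewrite -inSE => /(_ vS) /= h.
by case: (rep y) => //=; case: (adj y v); rewrite ?mul0n // !mul1n.
Qed.

Definition cost (C : nat -> nat) : nat := \sum_(y < n) rep y * clcost y (C y).

Lemma cost_lt C : cost C < B ^ 2.
Proof.
apply: (@leq_ltn_trans (n * n)); last by rewrite -mulnn; nia.
apply: leq_trans (leq_mul sum_csz_le (leqnn n)).
rewrite big_distrl; apply: leq_sum => y _ /=.
by rewrite -mulnA leq_mul2l clcost_csz_le orbT.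
Qed.

Lemma sum_wtE (C : nat -> nat) : \sum_(y < n) wt n k inS adj y (C y) =
  digits_of n (LC C) * B ^ k + cost C * B ^ (2 * k).
Proof.
under eq_bigr => y _ do rewrite /wt /wt_sum mulnDr.
rewrite big_split /=; congr (_ + _); last first.
  by rewrite /cost big_distrl; apply: eq_bigr => y _ /=; rewrite mulnA.
under eq_bigr => y _ do rewrite big_distrr /=.
rewrite exchange_big /digits_of big_distrl; apply: eq_bigr => v _ /=.
rewrite /LC !big_distrl big_distrr big_distrl; apply: eq_bigr => y _ /=.
rewrite expnD; case: (rep y); case: (inS v); case: (adj y v);
  by rewrite /= ?(mul0n, muln0, mul1n) // mulnCA mulnC.
Qed.

(** For valid data no addition carries: positions, counts and cost occupy separate blocks of digits,
    from which [fin] recovers them. *)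
Lemma decode p (C : nat -> nat) : encoded p C ->
  let s := p + \sum_(y < n) wt n k inS adj y (C y) in
  s < B ^ (2 * k + 2) /\ fin n k inS adj s = total p C.
Proof.
move=> enc; have [pB _] := enc.
have LCn v : v < n -> inS v -> LC C v <= n := LC_le enc.
have lowdB := digits_of_lt LCn; rewrite -/k in lowdB.
rewrite /= sum_wtE; set E := digits_of n _ in lowdB *; set c := cost C.
have cB : c < B ^ 2 := cost_lt C.
have lowB : p + E * B ^ k < B ^ (2 * k).
  rewrite mul2n -addnn expnD.
  by move: (B ^ k) pB lowdB => q; nia.
set s := p + _.
have sE : s = c * B ^ (2 * k) + (p + E * B ^ k) by rewrite /s; lia.
have sE' : s = p + (E + c * B ^ k) * B ^ k.
  by rewrite /s mul2n -addnn expnD mulnDl !mulnA.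
split.
  rewrite sE expnD.
  by move: (B ^ 2) (B ^ (2 * k)) cB lowB => q r; nia.
rewrite /fin /total; congr (_ + _).
  by rewrite sE divnMDl ?expn_gt0 // divn_small // addn0.
have th v : v < n -> inS v -> theta v s = theta v p.
  by move=> vn vS; rewrite sE' (theta_low (k := k)).
apply: eq_bigr => v _; case vS: (inS v) => //; rewrite !mul1n.
suff -> : lcount n k inS adj s v = LC C v + LS p v by [].
rewrite /lcount; congr (_ + _).
  rewrite /dig expnD divnMA sE' addnC divnMDl ?expn_gt0 // [p %/ _]divn_small // addn0.
  rewrite -/(dig n (idx inS v) _) dig_addM; last exact: idx_lt.
  by rewrite -/(theta v _) theta_digits_of.
apply: eq_bigr => u _; case uS: (inS u) => //=; case: (adj v u) => //=.
by rewrite /precedes !th.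
Qed.

Lemma data_of_layout (s : {perm 'I_n}) :
  exists p C, encoded p C /\ total p C = layout_imbalance e s.
Proof.
(* [digits_of] takes functions on [nat], so positions and counts are extended by 0 beyond the
   vertices. *)
pose pos v := if insub v is Some v' then val (s v') else 0.
pose cnt y v := if (insub y, insub v) is (Some y', Some v')
  then #|[set z in clq y' | s z < s v']| else 0.
have posE (v : 'I_n) : pos v = s v by rewrite /pos valK.
have cntE (y v : 'I_n) : cnt y v = #|[set z in clq y | s z < s v]|.
  by rewrite /cnt !valK.
have posn v : v < n -> inS v -> pos v <= n.
  by move=> vn _; rewrite (posE (Ordinal vn)) ltnW.
have cntn y v : v < n -> inS v -> cnt y v <= n.
  move=> vn _; rewrite /cnt; case: insub => // y'; case: insub => // v'.
  by rewrite -[leqRHS]card_ord max_card.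
pose p := digits_of n pos; pose C y := digits_of n (cnt y).
have tp (v : 'I_n) : v \in S -> theta v p = s v.
  by rewrite -inSE => vS; rewrite theta_digits_of.
have tC (y v : 'I_n) : v \in S -> theta v (C y) = #|[set z in clq y | s z < s v]|.
  by rewrite -inSE => vS; rewrite theta_digits_of // => u un uS; exact: cntn.
exists p, C; split.
  split; first by apply: digits_of_lt.
  move=> y yn; split; first by apply: digits_of_lt => v; exact: cntn.
  pose y' := Ordinal yn; rewrite -[y]/(val y').
  apply/forallP => v; apply/implyP; rewrite inSE => vS; apply/andP; split.
    rewrite tC // cszE; apply: subset_leq_card.
    by apply/subsetP => z; rewrite inE => /andP[].
  apply/forallP => w; apply/implyP; rewrite inSE => /andP[wS].
  rewrite !tp // => vw; rewrite !tC //; apply: subset_leq_card.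
  apply/subsetP => z; rewrite !inE => /andP[-> /=] zv.
  exact: leq_trans zv vw.
symmetry; apply: layout_total => [u v uS vS|y v _ vS _]; last exact: tC.
rewrite /precedes !tp //; case: (ltngtP (s u) (s v)) => //= /val_inj/perm_inj ->.
by rewrite ltnn.
Qed.

Lemma layout_of_data p C : encoded p C ->
  exists s : {perm 'I_n}, layout_imbalance e s = total p C.
Proof.
move=> enc.
pose rk (y z : 'I_n) := #|[set w in clq y | w < z]|.
pose gap z := \max_(v in S | theta v (C (root z)) <= rk (root z) z) (theta v p).+1.
(* A clique vertex is put right after the last v in S with [theta v] at most its
   rank; the keys are distinct because they are distinct modulo n. *)
pose key (u : 'I_n) := n * (if u \in S then 2 * theta u p + 1 else 2 * gap u) + u.
have injkey : injective key.
  move=> u v /(congr1 (modn^~ n)); rewrite /key !(mulnC n) !modnMDl !modn_small //.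
  exact: val_inj.
have [s sE] := perm_of_key injkey; exists s.
(* By monotonicity the vertices of S whose count is at most the rank of [z] are closed downwards in
   the order of [p], so they are exactly those placed below the gap. An empty maximum gives gap 0,
   before all of S. *)
have gapE z v : v \in S ->
    (theta v p < gap z) = (theta v (C (root z)) <= rk (root z) z).
  move=> vS; apply/idP/idP => [|tv]; last first.
    by rewrite /gap (bigD1 v) /= ?vS ?tv // leq_max leqnn.
  rewrite ltnNge; apply: contraNT; rewrite -ltnNge => tv.
  apply/bigmax_leqP => w /andP[wS tw]; rewrite ltnNge; apply/negP => vw.
  by have := theta_mono (root z) enc vS wS vw; rewrite leqNgt (leq_ltn_trans tw tv).
(* Parity separates the blocks: gap g has block 2g, just above the block 2(g - 1) + 1 of position g
   - 1 and below that of position g. *)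
have key_zv z v : z \notin S -> v \in S ->
    (key z < key v) = (rk (root z) z < theta v (C (root z))).
  move=> zS vS; rewrite [in RHS]ltnNge -gapE // -leqNgt /key (negbTE zS) vS.
  have := ltn_ord z; have := ltn_ord v; move: (theta v p) (gap z) => a b.
  case: (leqP b a); nia.
have root_clq (y z : 'I_n) : rep y -> z \in clq y -> root z = y.
  by move=> ry; rewrite -rootE // => /andP[_ /eqP].
apply: layout_total => [u v uS vS|y v ry vS eyv].
  rewrite sE /key uS vS /precedes; have := ltn_ord u; have := ltn_ord v.
  by move: (theta u p) (theta v p) => a b; case: (ltngtP a b); nia.
have yS : y \notin S by move: ry; rewrite repE => /andP[].
have -> : [set z in clq y | s z < s v] = [set z in clq y | rk y z < theta v (C y)].
  apply/setP => z; rewrite !inE -in_clq; case zy: (z \in clq y) => //=.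
  have zS : z \notin S by move: zy; rewrite in_clq => /andP[].
  by rewrite sE key_zv // (root_clq y).
rewrite -sum_card.
rewrite (eq_bigr (fun z => if z \in clq y then (rk y z < theta v (C y)) : nat else 0)) => [|z _]; last by case: (z \in clq y).
rewrite -big_mkcond /=.
(* The ranks run over 0, ..., [csz y] - 1, so the number of them below theta is the minimum of both,
   which is theta by [theta_csz]. *)
rewrite (sum_rank (f := fun z => val z) (fun j => j < theta v (C y))).
  rewrite sum_ltn_const; apply/esym/minn_idPr.
  by rewrite -cszE; exact: theta_csz enc vS.
by move=> ? ? _ _; exact: val_inj.
Qed.

Theorem table_correct T :
  [exists s : 'I_(B ^ (2 * k + 2)),
    cell_ok n k inS adj (n * B ^ (2 * k + 2) + s) && (fin n k inS adj s <= T)]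
  = (imbalance e <= T).
Proof.
have Big0 : 0 < B ^ (2 * k + 2) by rewrite expn_gt0.
have cellE s : s < B ^ (2 * k + 2) ->
    cell_ok n k inS adj (n * B ^ (2 * k + 2) + s) = reach n k inS adj n s.
  move=> sB; rewrite /cell_ok divnMDl // divn_small // addn0.
  by rewrite modnMDl modn_small.
rewrite /imbalance; case: arg_minnP => // s0 _ smin.
apply/existsP/idP => [[s /andP[]]|le_T].
  rewrite cellE // => /(reachP adj erefl)[p [C [pB HC sE]]].
  have enc : encoded p C by [].
  have [_] := decode enc; rewrite -sE => ->.
  have [s' <-] := layout_of_data enc.
  by apply: leq_trans; exact: smin.
have [p [C [enc totE]]] := data_of_layout s0.
have [sB finE] := decode enc.
exists (Ordinal sB); rewrite cellE //= finE totE le_T andbT.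
by apply/(reachP adj erefl); exists p, C; case: enc.
Qed.

End Graph.

(** * The running time *)

(** Affine functions suffice for f and g: f is constant and g has the form D k + 2 D. *)
Lemma computable_affine a b : computable (fun x => a * x + b).
Proof.
pose c := Seq (While 0 (Seq (repeat_cmd a (Basic (INC 1))) (Basic (DEC 0))))
  (Seq (Basic (CPY 0 1)) (repeat_cmd b (Basic (INC 0)))).
exists (code c 0) => x.
pose m0 : memory := fun r => if r == 0 then x else 0.
suff [m [t [bs _ m_ab]]] : runs x c m0 (fun m => m 0 = a * x + b).
  by exists t, m; split => //; exact: exec_program bs _.
pose I j (m : memory) := [/\ m 0 = j, m 1 = a * (x - j), m zr = 0 & j <= x].
have I0 : I x m0 by split; rewrite ?subnn ?muln0.
apply: runs_seq; apply: runs_mono (runs_while (I := I) _ _ (leqnn x) I0).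
- move=> m [m0_ m1 _ _]; apply: runs_seq; apply: runs_basic => //=.
  apply: runs_mono (runs_incs _ _ _ _) => m' [-> _].
  by rewrite /upd /= m1 subn0.
- by move=> m [].
- move=> j m jx [mj m1 mz _]; split; first by rewrite mj.
  apply: runs_seq; apply: runs_mono (runs_incs _ _ _ _) => m' [m'1 m'E].
  apply: runs_basic => //=; split; first by rewrite /upd /= m'E.
  split; rewrite /upd /=.
  + by rewrite m'E // mj.
  + by rewrite m'1 m1 -mulnSr; congr (_ * _); lia.
  + by rewrite m'E.
  + exact: ltnW.
Qed.

Section Encoding.
Variables (n : nat) (e : rel 'I_n) (S : {set 'I_n}) (t : int).
Local Notation orig := (encode e S t).

Lemma encode_bool a : a != 0 -> a != 2 -> orig a <= 1.
Proof.
by rewrite /encode => /negbTE -> /negbTE ->; case: (a == 1); exact: leq_b1.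
Qed.

Lemma encode_S (v : 'I_n) : (orig (3 + v) == 1) = (v \in S).
Proof.
rewrite /encode /= eqb1; apply/orP/idP => [[]|vS].
- by case/existsP=> i /andP[/eqP[/val_inj ->]].
- case/existsP=> i /existsP[j /andP[/eqP E _]].
  by move: E (ltn_ord v); rewrite -!addnA; move: (i * n + j) => q; lia.
- by left; apply/existsP; exists v; rewrite eqxx.
Qed.

Lemma encode_adj (u v : 'I_n) : (orig (3 + n + u * n + v) == 1) = e u v.
Proof.
rewrite /encode /= eqb1; apply/orP/idP => [[]|euv].
- case/existsP=> i /andP[/eqP E _].
  by move: E (ltn_ord i); rewrite -!addnA; move: (u * n + v) => q; lia.
- case/existsP=> i /existsP[j /andP[/eqP E eij]].
  have {}E : u * n + v = i * n + j by lia.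
  have n0 : 0 < n by exact: leq_ltn_trans (ltn_ord u).
  have ui : u = i.
    apply/val_inj; have /= := congr1 (divn^~ n) E.
    by rewrite !divnMDl // !divn_small ?addn0.
  have vj : v = j by apply/val_inj; move: E; rewrite ui => /addnI.
  by rewrite ui vj.
- right; apply/existsP; exists u; apply/existsP; exists v.
  by rewrite eqxx.
Qed.

End Encoding.

Lemma main_exec K : nv + 90 <= K -> exists C D, 
  forall n (e : rel 'I_n), symmetric e -> irreflexive e ->
  forall S : {set 'I_n}, twin_cover e S -> forall t : int,
  exists m : memory,
    exec (code (main K) 0) (C * n.+1 ^ (D * #|S| + 2 * D)) 0 (encode e S t) = Some m /\
    m 0 = nat_of_bool (Posz (imbalance e) <= t)%R.
Proof.
move=> K_ge; have [C [D cost_le]] := ccost_poly (main K).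
(* With c the constant factor of M, M + 1 is at most (c + 1) B^(4k + 8). Its D-th power gives the
   exponent (4k + 8) D = 4D k + 2 (4D). *)
exists (C * ((100 + K) * 2 ^ (2 * K)).+1 ^ D), (4 * D).
move=> n e e_sym e_irr S tc t.
set orig := encode e S t.
have orig1 : (orig 1 == 0) = ~~ (t < 0)%R by rewrite /orig /encode /= eqb0.
pose inS v := orig (3 + v) == 1.
pose adj i j := orig (3 + n + i * n + j) == 1.
have kS : idx inS n = #|S|.
  rewrite -sum1_card big_mkcond; apply: eq_bigr => v _.
  by rewrite /inS encode_S; case: (v \in S).
have [m [T [bs leT res]]] := runs_main K_ge (erefl : orig 0 = n) (@encode_bool _ e S t).
exists m; split.
  apply: exec_program bs _; apply: leq_trans leT _; apply: leq_trans (cost_le _) _.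
  rewrite kS -[leqRHS]mulnA leq_mul2l; apply/orP; right.
  have -> : 4 * D * #|S| + 2 * (4 * D) = (4 * #|S| + 8) * D by lia.
  rewrite [n.+1 ^ (_ * D)]expnM -expnMn.
  have [->|D0] := posnP D; first by rewrite !expn0.
  rewrite leq_exp2r // -addn1; move: (_ * 2 ^ _) => q.
  have : 0 < n.+1 ^ (4 * #|S| + 8) by rewrite expn_gt0.
  by move: (_ ^ _) => r; nia.
rewrite res (@table_correct n e S inS adj) //; first last.
- by move=> u v; exact: encode_adj.
- by move=> v; exact: encode_S.
rewrite orig1 /orig /encode /=; congr nat_of_bool.
by case: t {orig inS adj orig1 kS res bs leT} => t /=; lia.
Qed.

Theorem theorem2 :
  exists (P : program) (f g : nat -> nat),
    computable f /\ computable g /\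
    forall (n : nat) (e : rel 'I_n), symmetric e -> irreflexive e ->
    forall (S : {set 'I_n}), twin_cover e S ->
    forall (t : int),
      exists m : memory,
        exec P (f #|S| * (n.+1) ^ (g #|S|)) 0 (encode e S t) = Some m /\
        m 0 = nat_of_bool (Posz (imbalance e) <= t)%R.
Proof.
have [C [D HCD]] := main_exec (leqnn (nv + 90)).
exists (code (main (nv + 90)) 0), (fun k => 0 * k + C), (fun k => D * k + 2 * D).
split; first exact: computable_affine.
split; first exact: computable_affine.
exact: HCD.
Qed.
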